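(* Let $n\ge 4$ be an integer. For any $1<p_1,\dots,p_n\le\infty$ and $0<p<\infty$ with $\frac1{p_1}+\dots+\frac1{p_n}=\frac1p$, there exist a non-degenerate subspace $\Gamma\subseteq\mathbb{R}^n$ of maximal dimension $n-1$ and a symbol $m\in\mathcal{M}_\Gamma(\mathbb{R}^n)$ for which the associated $n$-linear multiplier operator $T_m$ does not map $L^{p_1}\times\dots\times L^{p_n}$ into $L^p$; that is, there is no finite constant $C$ such that $\|T_m(f_1,\dots,f_n)\|_{L^p(\mathbb{R})}\le C\prod_{j=1}^n\|f_j\|_{L^{p_j}(\mathbb{R})}$ for all Schwartz functions $f_1,\dots,f_n$ on $\mathbb{R}$.
   Context: For a linear subspace $\Gamma\subseteq\mathbb{R}^n$, $\mathcal{M}_\Gamma(\mathbb{R}^n)$ is the class of Marcinkiewicz–Hörmander–Mikhlin symbols singular along $\Gamma$: all bounded functions $m(\vec\eta)$ on $\mathbb{R}^n$ that are smooth in the complement of $\Gamma$ and satisfy $|\partial^\gamma m(\vec\eta)|\lesssim \operatorname{dist}(\vec\eta,\Gamma)^{-|\gamma|}$ for $\vec\eta\notin\Gamma$ and for sufficiently many multi-indices $\gamma$ (i.e. for all $|\gamma|\le M$, where $M$ is an arbitrary fixed sufficiently large integer; implicit constants may depend on $\gamma$). For $m\in\mathcal{M}_\Gamma(\mathbb{R}^n)$, the operator $T_m$ is defined on Schwartz functions by $$T_m(f_1,\dots,f_n)(x)=\int_{\mathbb{R}^n}m(\eta_1,\dots,\eta_n)\widehat{f_1}(\eta_1)\cdots\widehat{f_n}(\eta_n)e^{2\pi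 i x(\eta_1+\dots+\eta_n)}\,d\eta_1\cdots d\eta_n .$$ Non-degeneracy: a subspace $\Gamma\subseteq\mathbb{R}^n$ of dimension $k$ is non-degenerate if, setting $\eta_{n+1}:=-(\eta_1+\dots+\eta_n)$, for every choice of indices $1\le i_1<\dots<i_k\le n+1$ the subspace $\Gamma$ is a graph over the variables $(\eta_{i_1},\dots,\eta_{i_k})$, i.e. the linear map $\Gamma\to\mathbb{R}^k$, $\vec\eta\mapsto(\eta_{i_1},\dots,\eta_{i_k})$, is a bijection. *)

(* Defs.v *)
From HB Require Import structures.
From mathcomp Require Import all_boot all_order all_algebra.
From mathcomp Require Import all_classical all_reals all_analysis.
From mathcomp Require Import complex.

Set Implicit Arguments.
Unset Strict Implicit.
Unset Printing Implicit Defensive.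

Import Order.TTheory GRing.Theory Num.Theory.
Import numFieldNormedType.Exports.

Local Open Scope classical_set_scope.
Local Open Scope ring_scope.
Local Open Scope complex_scope.

(* The library has the product of two measures but no Lebesgue measure on R^n:
   it is built here on n.-tuple R, with its product sigma-algebra, as the n-fold
   product of the one-dimensional Lebesgue measure. *)
Section lebesgue_measure_tuple.
Context {R : realType}.
Local Notation mR := (measurableTypeR R).

Definition cons_pair n (x : mR * n.-tuple mR) : n.+1.-tuple mR :=
  [tuple of x.1 :: x.2].

Lemma measurable_cons_pair n : measurable_fun [set: mR * n.-tuple mR] (@cons_pair n).
Proof.
exact: (@measurable_cons _ _ _ _ fst n snd).
Qed.

Section step.
Variables (n : nat) (mu : {sigma_finite_measure set (n.-tuple mR) -> \bar R}).

Definition lebesgue_cons : set (n.+1.-tuple mR) -> \bar R :=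
  pushforward (@lebesgue_measure R \x mu)%E (@cons_pair n).

Let cons0 : lebesgue_cons set0 = 0%E.
Proof. by rewrite /lebesgue_cons /pushforward preimage_set0 measure0. Qed.

Let cons_ge0 A : (0 <= lebesgue_cons A)%E.
Proof. by rewrite /lebesgue_cons /pushforward measure_ge0. Qed.

Let cons_sigma_additive : semi_sigma_additive lebesgue_cons.
Proof.
move=> F mF tF mUF; rewrite /lebesgue_cons /pushforward preimage_bigcup.
have mc k : measurable (@cons_pair n @^-1` F k).
  by rewrite -[X in measurable X]setTI; exact: measurable_cons_pair.
apply: measure_semi_sigma_additive => //.
- apply/trivIsetP => /= i j _ _ ij; rewrite -preimage_setI.
  by move/trivIsetP : tF => /(_ _ _ _ _ ij) ->//; rewrite preimage_set0.
- exact: bigcup_measurable.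
Qed.

HB.instance Definition _ := isMeasure.Build _ _ _ lebesgue_cons
  cons0 cons_ge0 cons_sigma_additive.

Let cons_sigma_finite : sigma_finite setT lebesgue_cons.
Proof.
have /sigma_finiteP[F [TF ndF Foo]] := sigma_finiteT (@lebesgue_measure R).
have /sigma_finiteP[G [TG ndG Goo]] := sigma_finiteT mu.
pose uncons (t : n.+1.-tuple mR) : mR * n.-tuple mR :=
  (tnth t ord0, [tuple of behead t]).
have consK : cancel (@cons_pair n) uncons.
  by move=> [x t]; congr pair; apply: val_inj.
have muncons : measurable_fun [set: n.+1.-tuple mR] uncons.
  by apply: measurable_fun_pair; [exact: measurable_tnth|exact: measurable_behead].
exists (fun k => uncons @^-1` (F k `*` G k)).
  apply/seteqP; split => // t _.
  have : [set: mR] (tnth t ord0) by [].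
  have : [set: n.-tuple mR] [tuple of behead t] by [].
  rewrite TF TG => -[k _ Gk] [l _ Fl]; exists (maxn k l) => //; split => /=.
    by move: Fl; exact/subsetPset/ndF/leq_maxr.
  by move: Gk; exact/subsetPset/ndG/leq_maxl.
move=> k; have [mF Fk] := Foo k; have [mG Gk] := Goo k; split.
  rewrite -[X in measurable X]setTI; apply: muncons => //.
  exact: measurableX.
rewrite /lebesgue_cons /pushforward.
rewrite (_ : _ @^-1` (_ @^-1` _) = F k `*` G k); last first.
  by rewrite -comp_preimage (_ : _ \o _ = id)//; apply/funext => x; exact: consK.
by rewrite product_measure1E// lte_mul_pinfty// ge0_fin_numE.
Qed.

HB.instance Definition _ := Measure_isSigmaFinite.Build _ _ _ lebesgue_cons
  cons_sigma_finite.

End step.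

Fixpoint lebesgue_measure_tuple n :
    {sigma_finite_measure set (n.-tuple mR) -> \bar R} :=
  if n is k.+1 then lebesgue_cons (lebesgue_measure_tuple k)
  else \d_([tuple] : 0.-tuple mR).

End lebesgue_measure_tuple.

(* R[i] is not a normedModType over R and has no measurable structure, so
   integrals and derivatives are taken on the real and imaginary parts;
   [Normc.normc] is the R-valued modulus. *)

Section complex_valued.
Context {R : realType}.
Local Notation Re := (@complex.Re R).
Local Notation Im := (@complex.Im R).

Definition cintegral d (T : measurableType d) (mu : {measure set T -> \bar R})
    (f : T -> R[i]) : R[i] :=
  (\int[mu]_x Re (f x)) +i* (\int[mu]_x Im (f x)).

Definition cexpi (t : R) : R[i] := cos t +i* sin t.

Definition cLnorm d (T : measurableType d) (mu : {measure set T -> \bar R})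
    (p : \bar R) (f : T -> R[i]) : \bar R :=
  Lnorm mu p (fun x => (Normc.normc (f x))%:E).

Definition cderivable (f : R -> R[i]) (x : R) : Prop :=
  derivable (Re \o f) x 1 /\ derivable (Im \o f) x 1.

Definition cderive (f : R -> R[i]) (x : R) : R[i] :=
  (derive1 (Re \o f) x) +i* (derive1 (Im \o f) x).

Definition schwartz (f : R -> R[i]) : Prop :=
  (forall k x, cderivable (iter k cderive f) x) /\
  forall j k : nat, exists C : R, forall x,
    `|x| ^+ j * Normc.normc (iter k cderive f x) <= C.

Definition fourier (f : R -> R[i]) (xi : R) : R[i] :=
  cintegral lebesgue_measure (fun x => f x * cexpi (- (2 * pi * x * xi))).

End complex_valued.

Section symbols.
Context {R : realType} {n : nat}.
Local Notation Re := (@complex.Re R).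
Local Notation Im := (@complex.Im R).
Implicit Types (m : 'rV[R]_n -> R[i]) (eta : 'rV[R]_n)
  (G : {vspace 'rV[R]_n}).

Local Notation e_ i := (delta_mx 0 i : 'rV[R]_n).

Definition cpartial (i : 'I_n) m eta : R[i] :=
  ('D_(e_ i) (Re \o m) eta) +i* ('D_(e_ i) (Im \o m) eta).

Definition cpartials (s : seq 'I_n) m : 'rV[R]_n -> R[i] := foldr cpartial m s.

(* C^oo on a set U, meant to be open: all iterated partial derivatives, in any
   order, exist and are continuous at the points of U *)
Definition smooth_on (U : set 'rV[R]_n) m : Prop :=
  forall (s : seq 'I_n) eta, U eta ->
    [/\ {for eta, continuous (Re \o cpartials s m)},
        {for eta, continuous (Im \o cpartials s m)} &
        forall i, derivable (Re \o cpartials s m) eta (e_ i) /\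
                  derivable (Im \o cpartials s m) eta (e_ i)].

Definition multi_partial (g : 'I_n -> nat) m : 'rV[R]_n -> R[i] :=
  cpartials (flatten [seq nseq (g i) i | i <- enum 'I_n]) m.

Definition euclidean_norm eta : R := Num.sqrt (\sum_i eta 0 i ^+ 2).

Definition dist_subspace eta G : R :=
  inf [set euclidean_norm (eta - v) | v in [set` G]].

(* the Marcinkiewicz-Hoermander-Mikhlin class M_G(R^n), where M is the number
   of derivatives controlled *)
Definition mhm_symbol (M : nat) G m : Prop :=
  [/\ exists C : R, forall eta, Normc.normc (m eta) <= C,
      smooth_on [set eta | eta \notin G] m &
      forall g : 'I_n -> nat, (\sum_i g i <= M)%N ->
        exists C : R, forall eta, eta \notin G ->
          Normc.normc (multi_partial g m eta)
            <= C * dist_subspace eta G ^- (\sum_i g i)].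

(* eta_1, ..., eta_n, followed by eta_(n+1) = - (eta_1 + ... + eta_n) *)
Definition ext_coord eta (j : 'I_n.+1) : R :=
  if unlift ord_max j is Some i then eta 0 i else - \sum_i eta 0 i.

Definition nondegenerate_subspace G : Prop :=
  forall i : 'I_(\dim G) -> 'I_n.+1,
    {homo i : a b / (a < b)%N >-> (a < b)%N} ->
    bijective (fun v : subvs_of G =>
      \row_(a < \dim G) ext_coord (vsval v) (i a)).

(* a point of R^n is a row vector for [m], and a tuple for the measure *)
Definition multiplier_op m (f : 'I_n -> R -> R[i]) (x : R) : R[i] :=
  cintegral (lebesgue_measure_tuple n) (fun t =>
    m (\row_j tnth t j) * (\prod_j fourier (f j) (tnth t j))
    * cexpi (2 * pi * x * \sum_j tnth t j)).

End symbols.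

(* Main.v *)
Require Import Defs.
From mathcomp Require Import all_boot all_order all_algebra.
From mathcomp Require Import all_classical all_reals all_analysis.
From mathcomp Require Import measurable_realfun ess_sup_inf.
From mathcomp Require Import complex.
From mathcomp Require Import ring lra zify.

(** The size conditions on a symbol only see the distance to the subspace.  A
function supported in a strip of bounded width around a hyperplane, with
bounded derivatives, therefore satisfies them however wildly it behaves along
the hyperplane.  Let [Gamma] be the hyperplane [sum_j (j+1) eta_j = 0] (indices
from 0).  Put a translate of one fixed smooth bump in the unit cube at each
integer point [l] of [Gamma] and multiply it by a coefficient [eps l] of modulus
at most 1: every choice of [eps] gives an admissible symbol
([mhm_clattice_symbol]).  The hyperplane is non-degenerate because in the [n+1]
coordinates, which sum to 0, its equation has the distinct coefficients
[1, ..., n, 0] ([nondegenerate_weight_hyperplane]).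

Such a symbol is tested on functions whose Fourier transforms are sums of about
[N] bumps at consecutive integers with coefficients 1 and -1.  If these
coefficients form a Rudin-Shapiro sequence, the function is [O(sqrt N)] times a
fixed Schwartz function, so all its [L^p] norms are [O(sqrt N)] and the product
of the [n] norms is [O(N^(n/2))] ([test_fun_norms]).  On the other side [eps] can
cancel the signs of the inputs and replace them by a sign [b_k] that depends only
on the output frequency [k = sum_j l_j].  The equations [sum_j (j+1) l_j = 0] and
[sum_j l_j = k] leave [n-2] free integers, so every [k < N] is produced by exactly
[N^(n-2)] lattice points ([lattice_sum]), and [T(f_1, ..., f_n)(x)] is
[N^(n-2) sum_(k < N) b_k e^(2 pi i k x)] times a fixed function.  Taking [b]
Rudin-Shapiro as well gives size [N^(n-2) sqrt N].  As [n - 3/2 > n/2] when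
[n >= 4], no constant can work for all [N].

Two devices make this uniform.  A single symbol has to serve all [N]: the third
coordinate of [l] is confined to [[N, 2N)], so that [N = 2^s] can be read off
from [l] and the configurations belonging to different [N] use disjoint cubes.
And a lower bound for one Rudin-Shapiro polynomial is avoided: the two
polynomials [P] and [Q] of a Rudin-Shapiro pair satisfy [|P|^2 + |Q|^2 = 2N] on the
unit circle, so at every [x] one of them is at least [sqrt N].  Hence of the two
symbols built from [P] and from [Q] at least one defines an unbounded operator
([not_both_bounded]), for every [p > 0].

The test functions are inverse Fourier transforms of smooth compactly supported
functions, so the computation rests on Fourier inversion for these
([fourier_inv_fourier]) and on their being Schwartz functions
([schwartz_inv_fourier]). *)

Set Implicit Arguments.
Unset Strict Implicit.
Unset Printing Implicit Defensive.

Import Order.TTheory GRing.Theory Num.Theory.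
Import numFieldNormedType.Exports.

Local Open Scope classical_set_scope.
Local Open Scope ring_scope.
Local Open Scope complex_scope.

(** * A smooth bump and its derivatives *)

Section bump_function.
Context {R : realType}.
Implicit Types (x : R) (Q : {poly R}) (n : nat).

(** The derivative of [Q w^(-n) exp(-1/w)] with [w = x (1 - x)] is again of this form, with
exponent [n + 2] and this numerator. *)
Definition bump_num_step Q n : {poly R} :=
  let W := 'X * (1 - 'X) in
  Q^`() * W ^+ 2 - n%:R *: (Q * W^`() * W) + Q * W^`().

Fixpoint bump_num n : {poly R} :=
  if n is k.+1 then bump_num_step (bump_num k) k.*2 else 1.

Let w x : R := x * (1 - x).

Definition bump_formula n x : R :=
  (bump_num n).[x] * (w x)^-1 ^+ n.*2 * expR (- (w x)^-1).

(** The [n]-th derivative of [exp(-1/(x(1-x)))] extended by 0 outside [(0,1)]. *)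
Definition bump_derivn n x : R := if (0 < x) && (x < 1) then bump_formula n x else 0.

Let w_gt0 x : 0 < x -> x < 1 -> 0 < w x.
Proof. by move=> x0 x1; rewrite mulr_gt0 ?subr_gt0. Qed.

Lemma poly_bounded01 Q : exists C : R,
  0 <= C /\ forall x, 0 < x -> x < 1 -> `|Q.[x]| <= C.
Proof.
exists (\sum_(i < size Q) `|Q`_i|); split; first by apply: sumr_ge0.
move=> x x0 x1; rewrite horner_coef (le_trans (ler_norm_sum _ _ _))//.
apply: ler_sum => i _; rewrite normrM ler_piMr// normrX gtr0_norm//.
by rewrite exprn_ile1 ?ltW.
Qed.

(** The exponential beats every power of [w^(-1)], so all derivatives vanish to second
order at both ends of the interval; this is what makes the extension by 0 smooth. *)
Lemma bump_le_sqr n : exists C : R,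
  0 <= C /\ forall x, 0 < x -> x < 1 -> `|bump_derivn n x| <= C * w x ^+ 2.
Proof.
have [C [C0 HC]] := poly_bounded01 (bump_num n).
exists (C * (n.*2.+2)`!%:R); split; first by rewrite mulr_ge0.
move=> x x0 x1; rewrite /bump_derivn x0 x1 /= /bump_formula.
have w0 := w_gt0 x0 x1.
rewrite -mulrA normrM -mulrA ler_pM// ?HC//.
have wi0 : 0 < (w x)^-1 by rewrite invr_gt0.
rewrite ger0_norm; last by rewrite mulr_ge0 ?expR_ge0// exprn_ge0// ltW.
rewrite expRN.
rewrite ler_pdivrMr ?expR_gt0//.
have := @expR_ge1Dxn R _ n.*2.+1 (ltW wi0).
set e := expR _; set f := _%:R => He.
have f0 : 0 < f by rewrite ltr0n fact_gt0.
have {}He : (w x)^-1 ^+ n.*2.+2 <= f * e.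
  rewrite -ler_pdivrMl// mulrC; apply: le_trans He.
  by rewrite lerDr.
have -> : (w x)^-1 ^+ n.*2 = w x ^+ 2 * (w x)^-1 ^+ n.*2.+2.
  rewrite -[n.*2.+2]addn2 exprD mulrCA -exprMn mulfV ?gt_eqF//.
  by rewrite expr1n mulr1.
by rewrite [leRHS]mulrAC [leRHS]mulrC ler_wpM2l// exprn_ge0// ltW.
Qed.

Lemma is_derive_w x : is_derive x 1 w (1 - x *+ 2).
Proof.
rewrite (_ : w = (fun y => y) * (fun y => 1 - y))//.
apply: is_derive_eq; rewrite /=.
rewrite /GRing.scale /=; ring.
Qed.

Lemma horner_bump_num_step Q n x : (bump_num_step Q n).[x] =
  Q^`().[x] * w x ^+ 2 - n%:R * (Q.[x] * (1 - x *+ 2) * w x) + Q.[x] * (1 - x *+ 2).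
Proof.
have HW : ('X * (1 - 'X) : {poly R})^`().[x] = 1 - x *+ 2.
  rewrite derivM derivX derivB derivC derivX !hornerE; ring.
by rewrite /bump_num_step !hornerD hornerN hornerZ !hornerM HW !hornerE.
Qed.

Lemma is_derive_bump_formula n x : 0 < x -> x < 1 ->
  is_derive x 1 (bump_formula n) (bump_formula n.+1 x).
Proof.
move=> x0 x1; have w0 := w_gt0 x0 x1.
have wn0 : w x != 0 by rewrite gt_eqF.
have dw := is_derive_w x.
have dV : is_derive x 1 (fun y => (w y)^-1) (- (w x) ^- 2 *: (1 - x *+ 2)).
  exact: is_deriveV.
have dE : is_derive x 1 (expR \o (fun y => - (w y)^-1))
    (expR (- (w x)^-1) * - (- (w x) ^- 2 *: (1 - x *+ 2))).
  exact: is_derive1_comp.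
have dP := is_derive_poly (bump_num n) x.
have dX : is_derive x 1 ((fun y => (w y)^-1) ^+ n.*2)
   ((n.*2)%:R * (w x)^-1 ^+ n.*2.-1 *: (- (w x) ^- 2 *: (1 - x *+ 2))).
  exact: is_deriveX.
rewrite (_ : bump_formula n = horner (bump_num n) * ((fun y => (w y)^-1) ^+ n.*2)
   * (expR \o (fun y => - (w y)^-1))); last first.
  by apply/funext => y; rewrite /bump_formula !fctE.
apply: is_derive_eq.
rewrite /bump_formula !fctE /GRing.scale /=.
rewrite horner_bump_num_step doubleS.
rewrite -[(n.*2).+2]addn2 exprD; clear dw dV dE dP dX.
move: (w x) w0 wn0 => W W0 Wn0.
have HX : (n.*2)%:R * W^-1 ^+ n.*2.-1 = (n.*2)%:R * (W^-1 ^+ n.*2 * W) :> R.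
  case: (n.*2) => [|k]; first by rewrite !mul0r.
  by rewrite exprS mulrAC mulVf// mul1r.
rewrite HX; move: (_ ^+ n.*2) (expR _) (_.[x]) (_.[x]) (_%:R) => A E P P' k.
by rewrite -exprVn; field.
Qed.

Lemma bump_out n x : ~~ ((0 < x) && (x < 1)) -> bump_derivn n x = 0.
Proof. by rewrite /bump_derivn => /negbTE ->. Qed.

(** Inside the interval this is the formula.  Elsewhere [w] is at most the distance to
the point considered, and the quadratic bound forces the difference quotient to 0. *)
Lemma is_derive_bump n x : is_derive x 1 (bump_derivn n) (bump_derivn n.+1 x).
Proof.
have [/andP[x0 x1]|xout] := boolP ((0 < x) && (x < 1)).
  have -> : bump_derivn n.+1 x = bump_formula n.+1 x by rewrite /bump_derivn x0 x1.
  apply: near_eq_is_derive (is_derive_bump_formula n x0 x1).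
  near=> y.
  rewrite /bump_derivn ifT//; apply/andP; split; near: y; [exact: lt_nbhsr|exact: lt_nbhsl].
rewrite (bump_out _ xout).
have [C [C0 HC]] := bump_le_sqr n.
have bd y : `|bump_derivn n y| <= C * (y - x) ^+ 2.
  have [/andP[y0 y1]|yout] := boolP ((0 < y) && (y < 1)); last first.
    by rewrite bump_out// normr0 mulr_ge0// sqr_ge0.
  apply: (le_trans (HC _ y0 y1)); rewrite ler_wpM2l//.
  rewrite -(real_normK (num_real (y - x))) lerXn2r ?nnegrE//.
    by rewrite ltW// w_gt0.
  move: xout; rewrite negb_and -!leNgt => /orP[xle|xge].
    rewrite ger0_norm; last by lra.
    by apply: (@le_trans _ _ y); [rewrite /w ler_piMr ?ltW//; lra|lra].
  rewrite ler0_norm; last by lra.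
  by apply: (@le_trans _ _ (1 - y)); [rewrite /w ler_piMl//; lra|lra].
have lim0 : h^-1 *: ((bump_derivn n \o shift x) (h *: 1) - bump_derivn n x) @[h --> 0^'] --> (0 : R).
  apply/norm_cvg0P; apply: (@squeeze_cvgr _ _ _ _ (cst 0) (fun h => C * `|h|)).
  - near=> h; rewrite normr_ge0 /= (bump_out _ xout) subr0.
    have h0 : h != 0 by near: h; exact: nbhs_dnbhs_neq.
    rewrite normrM normfV ler_pdivrMl ?normr_gt0//.
    rewrite scaler1; apply: (le_trans (bd _)).
    by rewrite /= addrK -(real_normK (num_real h)) expr2 mulrCA mulrA.
  - exact: cvg_cst.
  - rewrite -[X in _ --> X](mulr0 C); apply: cvgM; first exact: cvg_cst.
    by rewrite -[X in _ --> X](normr0 R); apply: cvg_norm; apply: nbhs_dnbhs.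
split.
  by apply/cvg_ex; exists 0.
by rewrite /derive; apply/cvg_lim.
Unshelve. all: by end_near. Qed.

End bump_function.

(** * Smooth functions of compact support *)

Section compact_support.
Context {R : realType}.
Local Notation mu := (@lebesgue_measure R).
Implicit Types (L x : R) (f g h : R -> R).

Definition csupp L f := continuous f /\ forall x, L <= `|x| -> f x = 0.

Lemma csuppM L f g : csupp L f -> continuous g -> csupp L (fun x => f x * g x).
Proof.
move=> [cf f0] cg; split => [x|x /f0 ->]; last by rewrite mul0r.
by apply: cvgM; [exact: cf|exact: cg].
Qed.

Lemma csuppZ L f a : csupp L f -> csupp L (fun x => a * f x).
Proof.
move=> [cf f0]; split => [x|x /f0 ->]; last by rewrite mulr0.
by apply: cvgM; [exact: cvg_cst|exact: cf].
Qed.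

Lemma csupp_norm L f : csupp L f -> csupp L (fun x => `|f x|).
Proof.
move=> [cf f0]; split => [x|x /f0 ->]; last by rewrite normr0.
by apply: cvg_norm; exact: cf.
Qed.

Lemma patch_csupp L f : csupp L f -> f \_ `[- L, L] = f.
Proof.
move=> [cf f0]; apply/funext => x; rewrite patchE.
case: ifPn => // xL; rewrite f0//; apply: contraNT xL.
rewrite -ltNge ltr_norml => /andP[? ?].
by rewrite inE /= in_itv /= !ltW.
Qed.

Lemma integrable_csupp L f : csupp L f -> mu.-integrable setT (EFin \o f).
Proof.
move=> cf; rewrite -(patch_csupp cf) -restrict_EFin.
apply/(@integrable_mkcond _ _ _ mu `[- L, L]%classic (EFin \o f)) => //.
apply: continuous_compact_integrable; first exact: segment_compact.
by apply: continuous_subspaceT; case: cf.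
Qed.

Lemma Rintegral_csupp L f : csupp L f ->
  \int[mu]_x f x = \int[mu]_(x in `[- L, L]) f x.
Proof. by move=> cf; rewrite [RHS]Rintegral_mkcond patch_csupp. Qed.

Lemma integration_by_parts_csupp L f f' g g' : 0 < L -> csupp L f -> csupp L f' ->
  continuous g' ->
  (forall x, is_derive x 1 f (f' x)) -> (forall x, is_derive x 1 g (g' x)) ->
  \int[mu]_x (f' x * g x) = - \int[mu]_x (f x * g' x).
Proof.
move=> L0 cf cf' cg' df dg.
have cg : continuous g.
  by move=> x; apply/differentiable_continuous/derivable1_diffP; case: (dg x).
rewrite (Rintegral_csupp (csuppM cf cg')) (Rintegral_csupp (csuppM cf' cg)).
have LR h h' : continuous h -> (forall x, is_derive x 1 h (h' x)) ->
    derivable_oo_LRcontinuous h (- L) L.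
  move=> ch dh; split => [x _||]; first by case: (dh x).
    by apply: cvg_at_right_filter; exact: ch.
  by apply: cvg_at_left_filter; exact: ch.
under eq_Rintegral do rewrite mulrC.
rewrite (@Rintegration_by_parts R g f g' f')//.
- have [_ f0] := cf.
  rewrite !f0 ?normrN ?ler_norm// !mulr0 subrr sub0r; congr (- _).
  by apply: eq_Rintegral => x _; rewrite mulrC.
- by lra.
- exact: continuous_subspaceT.
- exact: LR cg dg.
- by move=> x _; rewrite derive1E; apply: derive_val.
- by apply: continuous_subspaceT; case: cf'.
- by apply: LR df; case: cf.
- by move=> x _; rewrite derive1E; apply: derive_val.
Qed.

(** The two cases of use are [h = cos] and [h = sin], the real and imaginary parts of
the Fourier kernel. *)
Lemma is_derive_under_csupp L f h (h' : R -> R) x : csupp L f -> continuous h' ->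
  (forall t : R, is_derive t 1 h (h' t)) -> (forall t, `|h' t| <= 1) ->
  is_derive x 1 (fun x => \int[mu]_y (f y * h (2 * pi * x * y)))
    (\int[mu]_y (2 * pi * y * f y * h' (2 * pi * x * y))).
Proof.
move=> cf ch' dh h'1.
have cid : continuous (fun y : R => 2 * pi * y).
  by move=> y; apply: cvgM; [exact: cvg_cst|exact: cvg_id].
have clin (z : R) : continuous (fun y : R => 2 * pi * z * y).
  by move=> y; apply: cvgM; [exact: cvg_cst|exact: cvg_id].
have ch : continuous h.
  by move=> t; apply/differentiable_continuous/derivable1_diffP; case: (dh t).
have cch z : continuous (fun y => h (2 * pi * z * y)).
  by move=> y; apply: (@continuous_comp _ _ _ (fun y => 2 * pi * z * y) h);
    [exact: clin|exact: ch].
have dxy (z y : R) : is_derive z 1 (fun x => f y * h (2 * pi * x * y))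
    (2 * pi * y * f y * h' (2 * pi * z * y)).
  have d1 : is_derive z 1 (fun x : R => 2 * pi * x * y) (2 * pi * y).
    rewrite (_ : (fun x : R => _) = (2 * pi * y) \*: id); last first.
      by apply/funext => t /=; rewrite /GRing.scale /= mulrAC.
    by apply: is_derive_eq; rewrite /GRing.scale /= mulr1.
  have d2 := @is_derive1_comp R h _ z _ _ (dh (2 * pi * z * y)) d1.
  rewrite (_ : (fun x => _) = f y \*: (h \o (fun x : R => 2 * pi * x * y))) //.
  apply: is_derive_eq. rewrite /GRing.scale /=. ring.
pose F (x y : R) := f y * h (2 * pi * x * y).
have iF z : mu.-integrable setT (EFin \o F z).
  exact: integrable_csupp (csuppM cf (cch z)).
pose G y := `|f y * (2 * pi * y)|.
have iG : mu.-integrable setT (EFin \o G).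
  exact: integrable_csupp (csupp_norm (csuppM cf cid)).
have pF z y : partial1of2 F z y = 2 * pi * y * f y * h' (2 * pi * z * y).
  rewrite partial1of2E; apply: derive_val.
have xI : `]x - 1, x + 1[%classic x by rewrite /= in_itv /=; lra.
have Gub z y : `]x - 1, x + 1[%classic z -> setT y -> `|partial1of2 F z y| <= G y.
  by move=> _ _; rewrite pF /G normrM [_ * f y]mulrC ler_piMr.
have dF z y : `]x - 1, x + 1[%classic z -> setT y -> derivable (F ^~ y) z 1.
  by move=> _ _; case: (dxy z y).
have D1 := @derivable_under_integral R _ _ mu F setT measurableT x (x-1) (x+1)
  xI (fun z _ => iF z) dF G (fun=> normr_ge0 _) iG Gub.
have D2 := @differentiation_under_integral R _ _ mu F setT measurableT x (x-1) (x+1)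
  xI (fun z _ => iF z) dF G (fun=> normr_ge0 _) iG Gub.
split => //; rewrite -derive1E D2.
by apply: eq_Rintegral => y _; exact: pF.
Qed.

End compact_support.

(** * The inverse Fourier transform *)

Section inverse_fourier.
Context {R : realType}.
Local Notation mu := (@lebesgue_measure R).
Local Notation Re := (@complex.Re R).
Local Notation Im := (@complex.Im R).
Local Notation normc := (@Normc.normc R).
Implicit Types (L x y : R) (f : R -> R) (F : nat -> R -> R).

Definition inv_fourier f x : R[i] :=
  Complex (\int[mu]_y (f y * cos (2 * pi * x * y)))
          (\int[mu]_y (f y * sin (2 * pi * x * y))).

(** A smooth function supported in [[-L, L]], presented as the family of its
derivatives: [F k] is the [k]-th derivative of [F 0]. *)
Definition jet L F := (forall k x, is_derive x 1 (F k) (F k.+1 x)) /\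
  forall k x, L <= `|x| -> F k x = 0.

Lemma is_derive_continuous (f f' : R -> R) :
  (forall x : R, is_derive x 1 f (f' x)) -> continuous f.
Proof.
by move=> df x; apply/differentiable_continuous/derivable1_diffP; case: (df x).
Qed.

Lemma jet_csupp L F k : jet L F -> csupp L (F k).
Proof. by move=> [dF F0]; split; [exact: is_derive_continuous (dF k)|exact: F0]. Qed.

Lemma jetS L F : jet L F -> jet L (fun k => F k.+1).
Proof. by move=> [dF F0]; split=> *; [exact: dF|exact: F0]. Qed.

(** The derivatives of [2 pi y F 0 y], by the Leibniz rule. *)
Definition jetX F k y := 2 * pi * y * F k y + 2 * pi * k%:R * F k.-1 y.

Lemma jet_jetX L F : jet L F -> jet L (jetX F).
Proof.
move=> [dF F0]; split => k x; last first.
  by move=> Lx; rewrite /jetX !F0// !mulr0 addr0.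
have d1 := dF k x.
rewrite /jetX.
case: k d1 => [|k] d1.
  rewrite (_ : (fun y => _) = cst (2 * pi) * (id * F 0%N)); last first.
    by apply/funext => y; rewrite /= !fctE /=; ring.
  apply: is_derive_eq; rewrite /GRing.scale /=; ring.
have d2 := dF k x.
rewrite (_ : (fun y => _) =
   cst (2 * pi) * (id * F k.+1) + cst (2 * pi * k.+1%:R) * F k); last first.
  by apply/funext => y; rewrite /= !fctE /=; ring.
apply: is_derive_eq; rewrite /GRing.scale /= -[k.+2%:R]natr1; ring.
Qed.

Lemma continuous_trig (h : R -> R) (a : R) : continuous h ->
  continuous (fun y : R => h (a * y)).
Proof.
move=> ch y; apply: (@continuous_comp _ _ _ (fun y => a * y) h); last exact: ch.
by apply: cvgM; [exact: cvg_cst|exact: cvg_id].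
Qed.

Lemma is_derive_trig (h h' : R -> R) (a : R) (x : R) :
  (forall t : R, is_derive t 1 h (h' t)) ->
  is_derive x 1 (fun y => h (a * y)) (a * h' (a * x)).
Proof.
move=> dh.
have d1 : is_derive x 1 (a \*: id) a.
  by apply: is_derive_eq; rewrite /GRing.scale /= mulr1.
have := @is_derive1_comp R h (a \*: id) x _ _ (dh _) d1.
by rewrite mulrC.
Qed.

Lemma is_derive_Re_inv_fourier L f x : csupp L f ->
  is_derive x 1 (Re \o inv_fourier f) (- Im (inv_fourier (fun y => 2 * pi * y * f y) x)).
Proof.
move=> cf; rewrite /inv_fourier /=.
have cs : continuous (fun t : R => - sin t).
  by move=> t; apply: cvgN; exact: continuous_sin.
have b t : `|- sin t| <= 1 :> R by rewrite normrN ler_norml sin_geN1 sin_le1.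
have := is_derive_under_csupp x cf cs (fun t => is_derive_cos t) b.
congr (is_derive _ _ _ _).
under eq_Rintegral do rewrite mulrN -mulN1r.
rewrite RintegralZl// ?mulN1r//.
apply: (integrable_csupp (L := L)).
apply: csuppM; last by apply: continuous_trig; exact: continuous_sin.
have -> : (fun y => 2 * pi * y * f y) = (fun y => f y * (2 * pi * y)).
  by apply/funext => y; rewrite mulrC.
by apply: csuppM => // y; apply: cvgM; [exact: cvg_cst|exact: cvg_id].
Qed.

Lemma is_derive_Im_inv_fourier L f x : csupp L f ->
  is_derive x 1 (Im \o inv_fourier f) (Re (inv_fourier (fun y => 2 * pi * y * f y) x)).
Proof.
move=> cf; rewrite /inv_fourier /=.
have b t : `|cos t| <= 1 :> R by rewrite ler_norml cos_geN1 cos_le1.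
exact: (is_derive_under_csupp x cf (@continuous_cos R) (fun t => is_derive_sin t) b).
Qed.

Lemma cderivable_inv_fourier L f x : csupp L f -> cderivable (inv_fourier f) x.
Proof.
by move=> cf; split; [have [] := is_derive_Re_inv_fourier x cf|have [] := is_derive_Im_inv_fourier x cf].
Qed.

Lemma cderive_inv_fourier L f x : csupp L f ->
  cderive (inv_fourier f) x = Complex 0 1 * inv_fourier (fun y => 2 * pi * y * f y) x.
Proof.
move=> cf; rewrite /cderive !derive1E.
have -> := @derive_val _ _ _ _ _ _ _ (is_derive_Re_inv_fourier x cf).
have -> := @derive_val _ _ _ _ _ _ _ (is_derive_Im_inv_fourier x cf).
case: (inv_fourier (fun _ => _) x) => a b; apply/eqP; rewrite eq_complex /=.
by rewrite !mul0r !mul1r sub0r add0r !eqxx.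
Qed.

Lemma cderiveZ (c : R[i]) (f : R -> R[i]) x : cderivable f x ->
  cderivable (fun y => c * f y) x /\ cderive (fun y => c * f y) x = c * cderive f x.
Proof.
case: c => a b [dR dI].
have dR' := DeriveDef dR erefl; have dI' := DeriveDef dI erefl.
have H1 : is_derive x 1 (Re \o (fun y => Complex a b * f y))
    (a * 'D_1 (Re \o f) x - b * 'D_1 (Im \o f) x).
  rewrite (_ : _ \o _ = cst a * (Re \o f) - cst b * (Im \o f)); last first.
    by apply/funext => y; rewrite !fctE /=; case: (f y).
  by apply: is_derive_eq; rewrite /GRing.scale /=; ring.
have H2 : is_derive x 1 (Im \o (fun y => Complex a b * f y))
    (a * 'D_1 (Im \o f) x + b * 'D_1 (Re \o f) x).
  rewrite (_ : _ \o _ = cst a * (Im \o f) + cst b * (Re \o f)); last first.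
    by apply/funext => y; rewrite !fctE /=; case: (f y) => ? ? /=; ring.
  by apply: is_derive_eq; rewrite /GRing.scale /=; ring.
split; first by split; [case: H1|case: H2].
rewrite /cderive !derive1E (@derive_val _ _ _ _ _ _ _ H1).
by rewrite (@derive_val _ _ _ _ _ _ _ H2).
Qed.

Lemma normcE (a b : R) : normc (Complex a b) = Num.sqrt (a ^+ 2 + b ^+ 2).
Proof. by []. Qed.

(** Integration by parts; iterated, it gives the rapid decay of the transform. *)
Lemma normc_inv_fourier_deriv L f f' x : 0 < L -> csupp L f -> csupp L f' ->
  (forall x : R, is_derive x 1 f (f' x)) ->
  normc (inv_fourier f' x) = 2 * pi * `|x| * normc (inv_fourier f x).
Proof.
move=> L0 cf cf' df.
have cc1 : continuous (fun y : R => 2 * pi * x * - sin (2 * pi * x * y)).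
  move=> y; apply: cvgM; first exact: cvg_cst.
  apply: cvgN; apply: continuous_trig; exact: continuous_sin.
have cc2 : continuous (fun y : R => 2 * pi * x * cos (2 * pi * x * y)).
  move=> y; apply: cvgM; first exact: cvg_cst.
  apply: continuous_trig; exact: continuous_cos.
have ER := integration_by_parts_csupp L0 cf cf' cc1 df
  (fun y => is_derive_trig (2 * pi * x) y (fun t => is_derive_cos t)).
have EI := integration_by_parts_csupp L0 cf cf' cc2 df
  (fun y => is_derive_trig (2 * pi * x) y (fun t => is_derive_sin t)).
have is' : mu.-integrable setT (EFin \o (fun y => f y * sin (2 * pi * x * y))).
  apply: (integrable_csupp (L := L)); apply: csuppM => //.
  by apply: continuous_trig; exact: continuous_sin.
have ic' : mu.-integrable setT (EFin \o (fun y => f y * cos (2 * pi * x * y))).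
  apply: (integrable_csupp (L := L)); apply: csuppM => //.
  by apply: continuous_trig; exact: continuous_cos.
rewrite /inv_fourier ER EI.
have -> : \int[mu]_y (f y * (2 * pi * x * - sin (2 * pi * x * y))) =
    - (2 * pi * x) * \int[mu]_y (f y * sin (2 * pi * x * y)).
  by rewrite -RintegralZl//; apply: eq_Rintegral => y _; ring.
have -> : \int[mu]_y (f y * (2 * pi * x * cos (2 * pi * x * y))) =
    2 * pi * x * \int[mu]_y (f y * cos (2 * pi * x * y)).
  by rewrite -RintegralZl//; apply: eq_Rintegral => y _; ring.
set c := Rintegral _ _ _; set s := Rintegral _ _ _.
rewrite !normcE mulNr opprK sqrrN !exprMn -mulrDr addrC.
rewrite sqrtrM; last by rewrite -!exprMn sqr_ge0.
by rewrite -!exprMn sqrtr_sqr !normrM ger0_norm// ger0_norm ?pi_ge0// mulrA.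
Qed.

Lemma normc_le (a b : R) : normc (Complex a b) <= `|a| + `|b|.
Proof.
rewrite normcE -[leRHS]ger0_norm ?addr_ge0// -sqrtr_sqr ler_wsqrtr//.
rewrite sqrrD -[a ^+ 2](real_normK (num_real a)) -[b ^+ 2](real_normK (num_real b)).
by rewrite lerD2r// lerDl mulrn_wge0 ?mulr_ge0.
Qed.

Lemma Re_le_normc (z : R[i]) : `|Re z| <= normc z.
Proof. by case: z => a b; rewrite normcE -sqrtr_sqr ler_wsqrtr// lerDl sqr_ge0. Qed.

Lemma Im_le_normc (z : R[i]) : `|Im z| <= normc z.
Proof. by case: z => a b; rewrite normcE -sqrtr_sqr ler_wsqrtr// lerDr sqr_ge0. Qed.

Lemma normc_inv_fourier_le L f x : csupp L f ->
  normc (inv_fourier f x) <= 2 * \int[mu]_y `|f y|.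
Proof.
move=> cf; apply: (le_trans (normc_le _ _)).
have H (h : R -> R) : continuous h -> (forall t, `|h t| <= 1) ->
    `|\int[mu]_y (f y * h (2 * pi * x * y))| <= \int[mu]_y `|f y|.
  move=> ch h1.
  have cfh := csuppM cf (continuous_trig (a := 2 * pi * x) ch).
  have ifh := integrable_csupp cfh.
  apply: (le_trans (le_normr_Rintegral _ ifh)) => //.
  apply: le_Rintegral => //.
  - exact: integrable_csupp (csupp_norm cfh).
  - exact: integrable_csupp (csupp_norm cf).
  - by move=> y _; rewrite normrM ler_piMr.
rewrite [leRHS]mulr_natl [leRHS]mulr2n lerD//; apply: H.
- exact: continuous_cos.
- by move=> t; rewrite ler_norml cos_geN1 cos_le1.
- exact: continuous_sin.
- by move=> t; rewrite ler_norml sin_geN1 sin_le1.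
Qed.

Lemma inv_fourier_decay L F j : 0 < L -> jet L F ->
  exists C, forall x, `|x| ^+ j * normc (inv_fourier (F 0%N) x) <= C.
Proof.
move=> L0; elim: j F => [|j IH] F jF.
  by exists (2 * \int[mu]_y `|F 0%N y|) => x; rewrite expr0 mul1r; apply: normc_inv_fourier_le (jet_csupp 0 jF).
have [C HC] := IH _ (jetS jF); exists (C / (2 * pi)) => x.
have := HC x; rewrite (normc_inv_fourier_deriv x L0 (jet_csupp 0 jF) (jet_csupp 1 jF) (jF.1 0%N)).
rewrite ler_pdivlMr ?mulr_gt0 ?pi_gt0//.
by congr (_ <= _); rewrite exprSr; ring.
Qed.

(** Each derivative in [x] brings down a factor [2 pi i y] in the integrand. *)
Lemma iter_cderive_inv_fourier L F k : jet L F ->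
  iter k cderive (inv_fourier (F 0%N)) = (fun x => Complex 0 1 ^+ k * inv_fourier (iter k jetX F 0%N) x)
  /\ jet L (iter k jetX F).
Proof.
move=> jF; elim: k => [|k [IH jk]].
  by split => //; apply/funext => x; rewrite expr0 mul1r.
rewrite iterS IH; split; last by rewrite iterS; exact: jet_jetX.
apply/funext => x.
have ck := jet_csupp 0 jk.
rewrite (cderiveZ _ (cderivable_inv_fourier x ck)).2 (cderive_inv_fourier x ck) mulrA exprSr.
congr (_ * inv_fourier _ x); apply/funext => y.
by rewrite iterS {2}/jetX /= mulr0 mul0r addr0.
Qed.

Lemma schwartz_inv_fourier L F : 0 < L -> jet L F -> schwartz (inv_fourier (F 0%N)).
Proof.
move=> L0 jF; split=> [k x|j k].
  have [-> jk] := iter_cderive_inv_fourier k jF.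
  by case: (cderiveZ (Complex 0 1 ^+ k) (cderivable_inv_fourier x (jet_csupp 0 jk))).
have [-> jk] := iter_cderive_inv_fourier k jF.
have [C HC] := inv_fourier_decay j L0 jk; exists C => x.
rewrite Normc.normcM (_ : normc (Complex 0 1 ^+ k) = 1) ?mul1r//.
elim: k {jk C HC} => [|k IH]; first by rewrite expr0 Normc.normc1.
by rewrite exprS Normc.normcM IH mulr1 normcE expr0n add0r expr1n sqrtr1.
Qed.

End inverse_fourier.

(** * The Poisson kernel *)

Section abel.
Context {R : realType}.
Local Notation mu := (@lebesgue_measure R).
Implicit Types (x y : R) (f g : R -> R).

Lemma Rintegral_itv_sym g (a : R) : 0 <= a -> continuous g ->
  \int[mu]_(x in `[- a, a]) g x = \int[mu]_(x in `[0, a]) (g x + g (- x)).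
Proof.
move=> a0 cg.
have ig (b c : R) : mu.-integrable `[b, c] (EFin \o g).
  apply: continuous_compact_integrable; first exact: segment_compact.
  exact: continuous_subspaceT.
have cgN : continuous (g \o -%R).
  by move=> x; apply: continuous_comp; [exact: opp_continuous|exact: cg].
have igN (b c : R) : mu.-integrable `[b, c] (EFin \o (g \o -%R)).
  apply: continuous_compact_integrable; first exact: segment_compact.
  exact: continuous_subspaceT.
rewrite RintegralD//.
have <- : \int[mu]_(x in `[- a, - 0]) g x = \int[mu]_(x in `[0, a]) g (- x).
  by rewrite /Rintegral integration_by_substitution_oppr//; exact: continuous_subspaceT.
rewrite oppr0.
have := @Rintegral_itvB R g (BLeft (- a)) (BRight a) 0 (ig _ _).
rewrite !bnd_simp oppr_le0 => /(_ a0 a0) H.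
rewrite -(@Rintegral_itv_obnd_cbnd R 0 (BRight a) g); last first.
  apply: (integrableS _ _ _ (ig 0 a)) => // x /=.
  by rewrite !in_itv /= => /andP[/ltW -> ->].
by rewrite -H subrK.
Qed.

Lemma cvg_Rintegral_itvT g : mu.-integrable setT (EFin \o g) ->
  \int[mu]_(x in `[- n%:R, n%:R]) g x @[n --> \oo] --> \int[mu]_x g x.
Proof.
move=> ig.
under eq_fun do rewrite Rintegral_mkcond.
have mg : measurable_fun setT g by apply/measurable_EFinP; case/integrableP: ig.
have H := @dominated_cvg _ _ _ mu setT measurableT
  (fun n => EFin \o (g \_ `[- n%:R, n%:R])) (EFin \o g) (abse \o (EFin \o g)).
apply: fine_cvg; rewrite fineK; last first.
  exact: integrable_fin_num.
apply: H => //.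
- move=> n; apply/measurable_EFinP.
  by apply/(measurable_restrictT _ _).1 => //; exact: measurable_funS mg.
- move=> x _; apply: cvg_near_cst.
  near=> n; rewrite /= patchE ifT// inE /= in_itv /= -ler_norml.
  by near: n; exact: nbhs_infty_ger.
- exact: integrable_abse.
- move=> n x _; rewrite /= patchE; case: ifP => _ //=.
  by rewrite normr0 lee_fin.
Unshelve. all: by end_near. Qed.

Lemma integrable_oneDsqrV :
  mu.-integrable setT (EFin \o (fun x : R => (1 + x ^+ 2)^-1)).
Proof.
have c1 : continuous (fun x : R => (1 + x ^+ 2)^-1) by exact: continuous_oneDsqrV.
have p1 x : 0 < (1 + x ^+ 2)^-1.
  by rewrite invr_gt0 (lt_le_trans ltr01)// lerDl sqr_ge0.
apply/integrableP; split.
  by apply/measurable_EFinP; apply: continuous_measurable_fun.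
under eq_integral do rewrite gee0_abs ?lee_fin ?(ltW (p1 _))//.
rewrite ge0_symfun_integralT//.
- have -> : [set x : R | (0 <= x)%R] = `[0%R, +oo[%classic.
    by apply/seteqP; split => x /=; rewrite in_itv /= andbT.
  by rewrite integral0y_oneDsqr -EFinM ltry.
- by move=> x; rewrite ltW.
- by move=> x; rewrite /= sqrrN.
Qed.

Lemma integrable_decay f (C : R) : continuous f ->
  (forall x, `|f x| <= C / (1 + x ^+ 2)) -> mu.-integrable setT (EFin \o f).
Proof.
move=> cf fC.
apply: (@le_integrable _ _ _ mu setT measurableT _ (EFin \o (fun x => C * (1 + x ^+ 2)^-1))).
- by apply/measurable_EFinP; apply: continuous_measurable_fun.
- by move=> x _; rewrite /= lee_fin (le_trans (fC x))// ler_norm.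
- exact: (integrableZl measurableT C integrable_oneDsqrV).
Qed.

Lemma continuous_expNabs (d : R) : continuous (fun x : R => expR (- (d * `|x|))).
Proof.
move=> x; apply: continuous_comp; last exact: continuous_expR.
apply: cvgN; apply: cvgM; first exact: cvg_cst.
exact: norm_continuous.
Qed.

Lemma integrable_expNabs (d : R) : 0 < d ->
  mu.-integrable setT (EFin \o (fun x : R => expR (- (d * `|x|)))).
Proof.
move=> d0; apply: (@integrable_decay _ (1 + 2 / d ^+ 2)).
  exact: continuous_expNabs.
move=> x; have x0 := normr_ge0 x.
have dx0 : 0 <= d * `|x| by rewrite mulr_ge0// ltW.
rewrite ger0_norm ?expR_ge0// expRN.
have x20 := sqr_ge0 x.
rewrite ler_pdivlMr; last by lra.
rewrite ler_pdivrMl ?expR_gt0//.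
have := @expR_ge1Dxn R _ 1 dx0.
rewrite (_ : 2`!%:R = 2)// exprMn real_normK ?num_real// => H.
have q0 : 0 < d ^+ 2 by rewrite exprn_gt0.
have qi0 : 0 < 2 / d ^+ 2 by rewrite divr_gt0.
apply: (@le_trans _ _ ((1 + d ^+ 2 * x ^+ 2 / 2) * (1 + 2 / d ^+ 2))); last first.
  by rewrite ler_wpM2r// ltW// addr_gt0.
rewrite mulrDl mul1r mulrDr mulr1.
have -> : d ^+ 2 * x ^+ 2 / 2 * (2 / d ^+ 2) = x ^+ 2.
  by field; rewrite gt_eqF.
have : 0 <= d ^+ 2 * x ^+ 2 / 2 by rewrite divr_ge0// mulr_ge0// ltW.
move: (d ^+ 2 * x ^+ 2 / 2) (2 / d ^+ 2) qi0 => s t; lra.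
Qed.

(** The transform of [exp(-d|x|)] is the Poisson kernel: an antiderivative on the
half-line is explicit. *)
Lemma integral_expNabs_cos (d v : R) : 0 < d ->
  \int[mu]_x (expR (- (d * `|x|)) * cos (v * x)) = 2 * d / (d ^+ 2 + v ^+ 2).
Proof.
move=> d0.
have D0 : 0 < d ^+ 2 + v ^+ 2 by rewrite ltr_pwDl ?exprn_gt0// sqr_ge0.
have ccos : continuous (fun x : R => cos (v * x)).
  by apply: continuous_trig; exact: continuous_cos.
have cg : continuous (fun x : R => expR (- (d * `|x|)) * cos (v * x)).
  by move=> x; apply: cvgM; [exact: continuous_expNabs|exact: ccos].
have ig : mu.-integrable setT (EFin \o (fun x : R => expR (- (d * `|x|)) * cos (v * x))).
  apply: (@le_integrable _ _ _ mu setT measurableT _ (EFin \o (fun x : R => expR (- (d * `|x|))))).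
  - by apply/measurable_EFinP; apply: continuous_measurable_fun.
  - move=> x _; rewrite /= lee_fin normrM ler_piMr//.
    by rewrite ler_norml cos_geN1 cos_le1.
  - exact: integrable_expNabs.
have := cvg_Rintegral_itvT ig.
pose E x : R := expR (- (d * x)) * (v * sin (v * x) - d * cos (v * x)) / (d ^+ 2 + v ^+ 2).
have dE x : is_derive x 1 E (expR (- (d * x)) * cos (v * x)).
  have d1 := is_derive_trig v x (fun t => is_derive_sin t).
  have d2 := is_derive_trig v x (fun t => is_derive_cos t).
  have d3 := is_derive_trig (- d) x (fun t => is_derive_expR t).
  rewrite (_ : E = (fun y => expR (- d * y)) *
     (cst v * (fun y => sin (v * y)) - cst d * (fun y => cos (v * y))) *
     cst (d ^+ 2 + v ^+ 2)^-1); last first.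
    by apply/funext => y; rewrite /E !fctE /= mulNr.
  apply: is_derive_eq; rewrite /GRing.scale /= !fctE mulNr.
  by field; rewrite gt_eqF.
have FE n : \int[mu]_(x in `[- n%:R, n%:R]) (expR (- (d * `|x|)) * cos (v * x))
   = 2 * (E n%:R - E 0).
  rewrite Rintegral_itv_sym//.
  transitivity (\int[mu]_(x in `[0, n%:R]) (2 * (expR (- (d * x)) * cos (v * x)))).
    apply: eq_Rintegral => x; rewrite inE /= in_itv /= => /andP[x0 _].
    by rewrite normrN mulrN cosN ger0_norm// mulr_natl.
  have ce : continuous (fun x : R => expR (- (d * x)) * cos (v * x)).
    move=> x; apply: cvgM; last exact: ccos.
    have := @continuous_trig _ expR (- d) (@continuous_expR R) x.
    by under [X in {for _, continuous X} -> _]eq_fun do rewrite mulNr.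
  rewrite RintegralZl//; last first.
    apply: continuous_compact_integrable; first exact: segment_compact.
    exact: continuous_subspaceT.
  congr (_ * _); case: n => [|n].
    by rewrite set_itv1 Rintegral_set1 subrr.
  rewrite /Rintegral (@continuous_FTC2 _ _ E)//.
  - exact: continuous_subspaceT.
  - have cE := is_derive_continuous dE.
    split => [x _||]; first by case: (dE x).
      by apply: cvg_at_right_filter; exact: cE.
    by apply: cvg_at_left_filter; exact: cE.
  - by move=> x _; rewrite derive1E; apply: derive_val.
under eq_fun do rewrite FE.
have En : E n%:R @[n --> \oo] --> (0 : R).
  apply/norm_cvg0P.
  apply: (@squeeze_cvgr _ _ _ _ (cst 0)
     (fun n => expR (- (d * n%:R)) * ((`|v| + d) / (d ^+ 2 + v ^+ 2)))).
  - near=> n; rewrite normr_ge0 /= /E -mulrA normrM ger0_norm ?expR_ge0//.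
    rewrite ler_wpM2l ?expR_ge0// normrM [`|_^-1|]gtr0_norm ?invr_gt0//.
    rewrite ler_wpM2r ?invr_ge0 ?(ltW D0)//.
    rewrite (le_trans (ler_normB _ _))// !normrM (gtr0_norm d0).
    rewrite lerD// ler_piMr ?normr_ge0 ?(ltW d0)// ler_norml.
      by rewrite sin_geN1 sin_le1.
    by rewrite cos_geN1 cos_le1.
  - exact: cvg_cst.
  - rewrite -[X in _ --> X](mul0r ((`|v| + d) / (d ^+ 2 + v ^+ 2))).
    apply: cvgM; last exact: cvg_cst.
    have : (fun n : nat => expR (- d) ^+ n) @ \oo --> (0 : R).
      by apply: cvg_expr; rewrite ger0_norm ?expR_ge0// expR_lt1 oppr_lt0.
    by under eq_fun do rewrite -expRM_natr mulNr.
move=> H.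
have H2 : 2 * (E n%:R - E 0) @[n --> \oo] --> 2 * (0 - E 0).
  by apply: cvgM; [exact: cvg_cst|apply: cvgB => //; exact: cvg_cst].
rewrite -(cvg_lim _ H)// (cvg_lim _ H2)//.
rewrite /E !mulr0 sin0 cos0 oppr0 expR0.
by field; rewrite gt_eqF.
Unshelve. all: by end_near. Qed.

End abel.

(** * Fourier inversion *)

Section inversion.
Context {R : realType}.
Local Notation mu := (@lebesgue_measure R).
Local Notation Re := (@complex.Re R).
Local Notation Im := (@complex.Im R).
Local Notation normc := (@Normc.normc R).
Implicit Types (L x y xi : R) (f : R -> R) (F : nat -> R -> R).

Let dl (n : nat) : R := n.+1%:R^-1.
Let dl_gt0 n : 0 < dl n. Proof. by rewrite invr_gt0. Qed.

Lemma cvg_atan_scale (u : R) :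
  atan (u * n.+1%:R) @[n --> \oo] --> Num.sg u * (pi / 2).
Proof.
have cvgy (v : R) : 0 < v -> atan (v * n.+1%:R) @[n --> \oo] --> pi / 2.
  move=> v0.
  have H : (fun n => v * n.+1%:R) @ \oo --> +oo.
    apply/cvgryPge => A; near=> n.
    rewrite -ler_pdivrMl//; apply: (@le_trans _ _ n%:R); last by rewrite ler_nat.
    by near: n; exact: nbhs_infty_ger.
  exact: cvg_comp H (@cvgy_atan R).
have [u0|u0|->] := ltgtP u 0.
- rewrite ltr0_sg// mulN1r.
  have u0' : 0 < - u by rewrite oppr_gt0.
  have /cvgN H := cvgy _ u0'.
  apply: (cvg_trans _ H); apply: near_eq_cvg; near=> n.
  by rewrite /= !fctE mulNr atanN opprK.
- by rewrite gtr0_sg// mul1r; exact: cvgy.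
- rewrite sgr0 mul0r; under eq_fun do rewrite mul0r atan0.
  exact: cvg_cst.
Unshelve. all: by end_near. Qed.

Lemma integrable_deriv_sg L f xi : csupp L f ->
  mu.-integrable setT (EFin \o (fun y => f y * Num.sg (y - xi))).
Proof.
move=> cf.
apply: (@le_integrable _ _ _ mu setT measurableT _ (EFin \o f)).
- apply/measurable_EFinP; apply: measurable_funM.
    by apply: continuous_measurable_fun; case: cf.
  rewrite (_ : (fun y => Num.sg (y - xi)) =
    (fun y => \1_(`]xi, +oo[%classic) y - \1_(`]-oo, xi[%classic) y)); last first.
    apply/funext => y; rewrite !indicE !mem_setE !in_itv /= andbT.
    have [h|h|->] := ltgtP y xi.
    + by rewrite ltr0_sg ?subr_lt0// sub0r.
    + by rewrite gtr0_sg ?subr_gt0// subr0.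
    + by rewrite subrr sgr0 subrr.
  by apply: measurable_funB; exact: measurable_indic.
- move=> y _; rewrite /= lee_fin normrM ler_piMr// normr_sg.
  by case: (_ == _).
- exact: integrable_csupp cf.
Qed.

(** The fundamental theorem of calculus on either side of [xi]. *)
Lemma Rintegral_deriv_sg L f f' xi : csupp L f -> csupp L f' ->
  (forall x : R, is_derive x 1 f (f' x)) ->
  \int[mu]_y (f' y * Num.sg (y - xi)) = - 2 * f xi.
Proof.
move=> cf cf' df.
(* [f] and its derivative vanish outside [[-M, M]], and [xi] is interior *)
pose M := Num.max L `|xi| + 1.
have LM : L < M by rewrite /M ltr_pwDr// le_max lexx.
have xM : `|xi| < M by rewrite /M ltr_pwDr// le_max lexx orbT.
have M0 : 0 < M by exact: le_lt_trans xM.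
have /andP[xiM1 xiM2] : - M < xi < M by rewrite -ltr_norml.
have f'M y : M <= `|y| -> f' y = 0.
  by move=> My; apply: cf'.2; rewrite (le_trans _ My)// ltW.
have f0 y : M <= `|y| -> f y = 0.
  by move=> My; apply: cf.2; rewrite (le_trans _ My)// ltW.
have ig (b c : R) : mu.-integrable `[b, c] (EFin \o f').
  apply: continuous_compact_integrable; first exact: segment_compact.
  by apply: continuous_subspaceT; case: cf'.
pose g y := f' y * Num.sg (y - xi).
have igT : mu.-integrable setT (EFin \o g).
  exact: integrable_deriv_sg cf'.
have igI (A : set R) : measurable A -> mu.-integrable A (EFin \o g).
  by move=> mA; apply: integrableS igT.
have gM : g \_ `[- M, M] = g.
  apply/funext => y; rewrite patchE; case: ifPn => // yM; rewrite /g f'M ?mul0r//.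
  apply: contraNT yM; rewrite -ltNge ltr_norml => /andP[? ?].
  by rewrite inE /= in_itv /= !ltW.
rewrite -/(g _) -[LHS]/(\int[mu]_y g y) -gM -Rintegral_mkcond.
have FTC (a b : R) : a < b -> \int[mu]_(y in `[a, b]) f' y = f b - f a.
  move=> ab; rewrite /Rintegral (@continuous_FTC2 _ f' f)//.
  - by apply: continuous_subspaceT; case: cf'.
  - split => [x _||]; first by case: (df x).
      by apply: cvg_at_right_filter; exact: cf.1.
    by apply: cvg_at_left_filter; exact: cf.1.
  - by move=> x _; rewrite derive1E; apply: derive_val.
have := @Rintegral_itvB R g (BLeft (- M)) (BRight M) xi (igI _ _).
rewrite !bnd_simp => /(_ (measurable_itv _) (ltW xiM1) (ltW xiM2)) /eqP.
rewrite subr_eq => /eqP ->.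
have -> : \int[mu]_(x in `]xi, M]) g x = - f xi.
  transitivity (\int[mu]_(x in `]xi, M]) f' x).
    apply: eq_Rintegral => y; rewrite inE /= in_itv /= => /andP[xy _].
    by rewrite /g gtr0_sg ?subr_gt0// mulr1.
  rewrite Rintegral_itv_obnd_cbnd; last first.
    apply: (integrableS _ _ _ (ig xi M)) => // x /=.
    by rewrite !in_itv /= => /andP[/ltW -> ->].
  by rewrite FTC// f0 ?sub0r// ger0_norm ?(ltW M0).
have -> : \int[mu]_(x in `[- M, xi]) g x = - f xi.
  rewrite -Rintegral_itv_bndo_bndc; last exact: igI.
  transitivity (\int[mu]_(x in `[- M, xi[) (- 1 * f' x)).
    apply: eq_Rintegral => y; rewrite inE /= in_itv /= => /andP[_ xy].
    by rewrite /g ltr0_sg ?subr_lt0// mulrN1 mulN1r.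
  have iM : mu.-integrable `[- M, xi[ (EFin \o f').
    apply: (integrableS _ _ _ (ig (- M) xi)) => // x /=.
    by rewrite !in_itv /= => /andP[-> /ltW].
  rewrite RintegralZl// Rintegral_itv_bndo_bndc// FTC// (f0 (- M)) ?subr0 ?mulN1r//.
  by rewrite normrN ger0_norm ?(ltW M0).
ring.
Qed.

(** The Poisson kernel is the derivative of [atan(2 pi (y - xi)/d)/pi].  Once it is moved
onto [f], the limit [d -> 0] only needs the pointwise limits of [atan] at infinity. *)
Lemma poisson_by_parts L f f' xi (d : R) : 0 < L -> 0 < d -> csupp L f -> csupp L f' ->
  (forall x : R, is_derive x 1 f (f' x)) ->
  \int[mu]_y (f y * (2 * d / (d ^+ 2 + (2 * pi * (y - xi)) ^+ 2))) =
  - \int[mu]_y (f' y * (pi^-1 * atan ((2 * pi * (y - xi)) / d))).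
Proof.
move=> L0 d0 cf cf' df.
have p0 := @pi_gt0 R.
have D0 y : 0 < d ^+ 2 + (2 * pi * (y - xi)) ^+ 2.
  by rewrite ltr_pwDl ?exprn_gt0// sqr_ge0.
have dA y : is_derive y 1 (fun y => pi^-1 * atan ((2 * pi * (y - xi)) / d))
    (2 * d / (d ^+ 2 + (2 * pi * (y - xi)) ^+ 2)).
  have d1 : is_derive y 1 (fun y => (2 * pi * (y - xi)) / d) (2 * pi / d).
    rewrite (_ : (fun y => _) = cst (2 * pi) * (id - cst xi) * cst d^-1)//.
    by apply: is_derive_eq; rewrite /GRing.scale /=; ring.
  have d2 : is_derive (2 * pi * (y - xi) / d) 1 (@atan R)
      (1 + (2 * pi * (y - xi) / d) ^+ 2)^-1.
    by split; [exact: derivable_atan|rewrite -derive1E derive1_atan].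
  have d3 := @is_derive1_comp R atan (fun y => 2 * pi * (y - xi) / d) y _ _ d2 d1.
  rewrite (_ : (fun y => _) = cst pi^-1 * (atan \o (fun y => (2 * pi * (y - xi)) / d)))//.
  apply: is_derive_eq; rewrite /GRing.scale /=.
  have := D0 y; clear d1 d2 d3; move: (@pi R) p0 => P P0 Dy.
  by field; rewrite !gt_eqF.
have cq : continuous (fun y => 2 * pi * (y - xi)).
  move=> y; apply: cvgM; first exact: cvg_cst.
  by apply: cvgB; [exact: cvg_id|exact: cvg_cst].
rewrite (integration_by_parts_csupp L0 cf cf' _ df dA) ?opprK//.
move=> y; apply: cvgM; first exact: cvg_cst.
apply: cvgV; first by rewrite gt_eqF.
apply: cvgD; first exact: cvg_cst.
under eq_fun do rewrite expr2.
by rewrite expr2; apply: cvgM; exact: cq.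
Qed.

Lemma continuous_inv_fourier L F : jet L F -> continuous (Re \o inv_fourier (F 0%N)) /\
  continuous (Im \o inv_fourier (F 0%N)).
Proof.
move=> jF; split.
  exact: is_derive_continuous (fun x => is_derive_Re_inv_fourier x (jet_csupp 0 jF)).
exact: is_derive_continuous (fun x => is_derive_Im_inv_fourier x (jet_csupp 0 jF)).
Qed.

Lemma continuous_cexpi (a : R) : continuous (fun x : R => cos (a * x)) /\
  continuous (fun x : R => sin (a * x)).
Proof.
by split; apply: continuous_trig; [exact: continuous_cos|exact: continuous_sin].
Qed.

Lemma normc_cexpi x : normc (cexpi x) = 1.
Proof. by rewrite normcE cos2Dsin2 sqrtr1. Qed.

Lemma quadratic_decay (f : R -> R[i]) :
  (forall j, exists C, forall x, `|x| ^+ j * normc (f x) <= C) ->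
  exists C, forall x, normc (f x) <= C / (1 + x ^+ 2).
Proof.
move=> dec; have [C0 H0] := dec 0%N; have [C2 H2] := dec 2%N.
exists (C0 + C2) => x.
rewrite ler_pdivlMr; last by rewrite (lt_le_trans ltr01)// lerDl sqr_ge0.
rewrite mulrDr mulr1 lerD//; first by have := H0 x; rewrite expr0 mul1r.
by have := H2 x; rewrite real_normK ?num_real// mulrC.
Qed.

(** Abel summation.  The integral over [x] of the real part of the integrand is the
limit, as [d] tends to 0, of its integral against [exp(-d|x|)]; for [d > 0] Fubini's
theorem turns the latter into the integral of [F 0] against the Poisson kernel. *)
Lemma fourier_inv_fourier L F xi : 0 < L -> jet L F ->
  fourier (inv_fourier (F 0%N)) xi = Complex (F 0%N xi) 0.
Proof.
move=> L0 jF.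
have jF0 := jet_csupp 0 jF; have jF1 := jet_csupp 1 jF.
pose f := F 0%N; pose h x := inv_fourier f x * cexpi (- (2 * pi * x * xi)).
have [cR cI] := continuous_inv_fourier jF.
have [cc1 cs1] := continuous_cexpi (- (2 * pi * xi)).
have cR' : continuous (Re \o h).
  rewrite (_ : Re \o h = (fun x => Re (inv_fourier f x) * cos (- (2 * pi * xi) * x) -
    Im (inv_fourier f x) * sin (- (2 * pi * xi) * x))); last first.
    apply/funext => x; rewrite /h /= /cexpi; case: (inv_fourier f x) => a b /=.
    by rewrite mulNr (_ : 2 * pi * xi * x = 2 * pi * x * xi)//; ring.
  move=> x; apply: cvgB; apply: cvgM; [exact: cR|exact: cc1|exact: cI|exact: cs1].
have cI' : continuous (Im \o h).
  rewrite (_ : Im \o h = (fun x => Re (inv_fourier f x) * sin (- (2 * pi * xi) * x) +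
    Im (inv_fourier f x) * cos (- (2 * pi * xi) * x))); last first.
    apply/funext => x; rewrite /h /= /cexpi; case: (inv_fourier f x) => a b /=.
    by rewrite mulNr (_ : 2 * pi * xi * x = 2 * pi * x * xi)//; ring.
  move=> x; apply: cvgD; apply: cvgM; [exact: cR|exact: cs1|exact: cI|exact: cc1].
have [C HC] : exists C, forall x, normc (h x) <= C / (1 + x ^+ 2).
  apply: quadratic_decay => j; have [C HC] := inv_fourier_decay j L0 jF.
  by exists C => x; rewrite Normc.normcM normc_cexpi mulr1.
have iR : mu.-integrable setT (EFin \o (Re \o h)).
  by apply: (integrable_decay (C := C)) => // x; apply: le_trans (HC x); exact: Re_le_normc.
have iI : mu.-integrable setT (EFin \o (Im \o h)).
  by apply: (integrable_decay (C := C)) => // x; apply: le_trans (HC x); exact: Im_le_normc.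
have cosc (x : R) : continuous (fun y => cos (2 * pi * x * y)).
  by apply: continuous_trig; exact: continuous_cos.
have sinc (x : R) : continuous (fun y => sin (2 * pi * x * y)).
  by apply: continuous_trig; exact: continuous_sin.
have icc x (a : R) : mu.-integrable setT (EFin \o (fun y => f y * cos (2 * pi * x * y) * a)).
  by apply: (integrable_csupp (L := L)); apply: csuppM; [exact: csuppM|move=> ?; exact: cvg_cst].
have isc x (a : R) : mu.-integrable setT (EFin \o (fun y => f y * sin (2 * pi * x * y) * a)).
  by apply: (integrable_csupp (L := L)); apply: csuppM; [exact: csuppM|move=> ?; exact: cvg_cst].
have EcZ x (a : R) : (\int[mu]_y (f y * cos (2 * pi * x * y))) * a =
   \int[mu]_y (f y * cos (2 * pi * x * y) * a).
  by rewrite RintegralZr//; exact: integrable_csupp (csuppM jF0 (cosc x)).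
have EsZ x (a : R) : (\int[mu]_y (f y * sin (2 * pi * x * y))) * a =
   \int[mu]_y (f y * sin (2 * pi * x * y) * a).
  by rewrite RintegralZr//; exact: integrable_csupp (csuppM jF0 (sinc x)).
have RhE x : Re (h x) = \int[mu]_y (f y * cos (2 * pi * x * (y - xi))).
  rewrite /h /inv_fourier /= cosN sinN mulrN opprK EcZ EsZ -RintegralD//.
  by apply: eq_Rintegral => y _; rewrite mulrBr cosB; ring.
have IhE x : Im (h x) = \int[mu]_y (f y * sin (2 * pi * x * (y - xi))).
  rewrite /h /inv_fourier /= cosN sinN mulrN addrC EcZ EsZ -RintegralB//.
  by apply: eq_Rintegral => y _; rewrite mulrBr sinB; ring.
rewrite /fourier /cintegral -/f; congr Complex; last first.
  (* the imaginary part of the integrand is odd *)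
  have := cvg_Rintegral_itvT iI.
  under eq_fun do rewrite Rintegral_itv_sym//.
  have -> : (fun n : nat => \int[mu]_(x in `[0, n%:R]) ((Im \o h) x + (Im \o h) (- x))) = cst 0.
    apply/funext => n; rewrite -[RHS](@Rintegral_set0 _ _ R mu (cst 0)).
    rewrite Rintegral_set0 -[RHS](mul0r (fine (mu `[0, n%:R]))).
    rewrite -Rintegral_cst//; apply: eq_Rintegral => x _.
    rewrite /comp !IhE.
    have -> : \int[mu]_y (f y * sin (2 * pi * - x * (y - xi))) =
      \int[mu]_y (-1 * (f y * sin (2 * pi * x * (y - xi)))).
      apply: eq_Rintegral => y _.
      by rewrite (_ : 2 * pi * - x * (y - xi) = - (2 * pi * x * (y - xi))) ?sinN; ring.
    rewrite RintegralZl//; first by rewrite mulN1r subrr.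
    apply: (integrable_csupp (L := L)); apply: csuppM => // y.
    apply: continuous_comp; last exact: continuous_sin.
    apply: cvgM; first exact: cvg_cst.
    by apply: cvgB; [exact: cvg_id|exact: cvg_cst].
  by move=> H; rewrite -[LHS]/(\int[mu]_x (Im \o h) x) -(cvg_lim _ H)// lim_cst.
have lim1 : \int[mu]_x (Re (h x) * expR (- (dl n * `|x|))) @[n --> \oo] -->
    \int[mu]_x Re (h x).
  apply: fine_cvg; rewrite fineK; last exact: integrable_fin_num.
  apply: (@dominated_cvg _ _ _ mu setT measurableT
    (fun n x => (Re (h x) * expR (- (dl n * `|x|)))%:E) (EFin \o (Re \o h))
    (abse \o (EFin \o (Re \o h)))) => //.
  - move=> n; apply/measurable_EFinP; apply: measurable_funM.
      exact: continuous_measurable_fun.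
    by apply: continuous_measurable_fun; exact: continuous_expNabs.
  - move=> x _; apply: cvg_EFin; first exact: nearW.
    rewrite /comp /= -[X in _ --> X]mulr1; apply: cvgM; first exact: cvg_cst.
    rewrite -(@expR0 R); apply: continuous_cvg; first exact: continuous_expR.
    rewrite -oppr0; apply: cvgN; rewrite -(mul0r `|x|).
    by apply: cvgM; [exact: cvg_harmonic|exact: cvg_cst].
  - exact: integrable_abse.
  - move=> n x _; rewrite /= lee_fin normrM ler_piMr//.
    rewrite ger0_norm ?expR_ge0// -expR0 ler_expR oppr_le0 mulr_ge0//.
    by rewrite ltW.
have fub n : \int[mu]_x (Re (h x) * expR (- (dl n * `|x|))) =
    \int[mu]_y (f y * (2 * dl n / (dl n ^+ 2 + (2 * pi * (y - xi)) ^+ 2))).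
  pose k (z : measurableTypeR R * measurableTypeR R) : \bar R :=
    (f z.2 * cos (2 * pi * z.1 * (z.2 - xi)) * expR (- (dl n * `|z.1|)))%:E.
  have cmeas (g : R -> R) : continuous g -> measurable_fun setT g.
    exact: continuous_measurable_fun.
  have m1 : measurable_fun setT (fun z : measurableTypeR R * measurableTypeR R => z.1).
    exact: measurable_fst.
  have m2 : measurable_fun setT (fun z : measurableTypeR R * measurableTypeR R => z.2).
    exact: measurable_snd.
  have mk : measurable_fun setT k.
    apply/measurable_EFinP; apply: measurable_funM; last first.
      exact: (measurableT_comp (cmeas _ (@continuous_expNabs R (dl n))) m1).
    apply: measurable_funM.
      exact: (measurableT_comp (cmeas _ jF0.1) m2).
    apply: (measurableT_comp (cmeas _ (@continuous_cos R))).
    apply: measurable_funM; first exact: measurable_funM.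
    exact: measurable_funB.
  have kc (x : R) : continuous (fun y : R => cos (2 * pi * x * (y - xi))).
    move=> y; apply: continuous_comp; last exact: continuous_cos.
    apply: cvgM; first exact: cvg_cst.
    by apply: cvgB; [exact: cvg_id|exact: cvg_cst].
  have iex := integrable_expNabs (dl_gt0 n).
  have ik : (mu \x mu)%E.-integrable setT k.
    apply/(@integrable12ltyP _ _ _ _ _ mu mu k mk).
    have iaf := integrable_csupp (csupp_norm jF0).
    apply: (@le_lt_trans _ _ (\int[mu]_x ((\int[mu]_y `|f y|) *
       expR (- (dl n * `|x|)))%:E)%E); last first.
      apply: integrable_lty => //.
      exact: (integrableZl measurableT (\int[mu]_y `|f y|) iex).
    apply: ge0_le_integral => //.
    - by move=> x _; apply: integral_ge0.
    - apply: (@measurable_fun_fubini_tonelli_F _ _ _ _ _ mu (fun z => `|k z|%E)) => //.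
      exact: measurableT_comp.
    - apply/measurable_EFinP; apply: measurable_funM => //.
      by apply: cmeas; exact: continuous_expNabs.
    - move=> x _; rewrite /Rintegral EFinM fineK; last exact: integrable_fin_num.
      rewrite muleC -ge0_integralZl//; last first.
        by apply/measurable_EFinP; apply: cmeas; case: (csupp_norm jF0).
      apply: ge0_le_integral => //.
      + apply: (@measurableT_comp _ _ _ _ _ _ (@abse R)) => //.
        apply/measurable_EFinP; apply: measurable_funM => //.
          exact: cmeas (csuppM jF0 (kc x)).1.
        apply: (measurable_cst (expR (- (dl n * `|x|)))).
      + apply: emeasurable_funM => //; apply/measurable_EFinP.
        by apply: cmeas; case: (csupp_norm jF0).
      + move=> y _; rewrite /k /= lee_fin !normrM mulrC.
        rewrite [`|expR _|]ger0_norm ?expR_ge0// ler_wpM2l ?expR_ge0//.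
        by rewrite ler_piMr// ler_norml cos_geN1 cos_le1.
  have inner x : (\int[mu]_y k (x, y))%E = (Re (h x) * expR (- (dl n * `|x|)))%:E.
    have ifc := integrable_csupp (csuppM jF0 (kc x)).
    rewrite RhE -RintegralZr// /Rintegral fineK//.
    apply: integrable_fin_num => //.
    apply: (integrable_csupp (L := L)); apply: csuppM; first exact: csuppM.
    by move=> ?; exact: cvg_cst.
  transitivity (fine (\int[mu]_x \int[mu]_y k (x, y))%E).
    by congr fine; apply: eq_integral => x _; rewrite inner.
  rewrite (Fubini ik); congr fine; apply: eq_integral => y _.
  have -> : 2 * dl n / (dl n ^+ 2 + (2 * pi * (y - xi)) ^+ 2) =
     \int[mu]_x (expR (- (dl n * `|x|)) * cos (2 * pi * (y - xi) * x)).
    by rewrite integral_expNabs_cos.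
  have iec : mu.-integrable setT (EFin \o
      (fun x : R => expR (- (dl n * `|x|)) * cos (2 * pi * (y - xi) * x))).
    apply: (@le_integrable _ _ _ mu setT measurableT _ (EFin \o (fun x : R => expR (- (dl n * `|x|))))) => //.
    - apply/measurable_EFinP; apply: measurable_funM.
        by apply: cmeas; exact: continuous_expNabs.
      by apply: cmeas; apply: continuous_trig; exact: continuous_cos.
    - move=> x _; rewrite /= lee_fin normrM ler_piMr//.
      by rewrite ler_norml cos_geN1 cos_le1.
  rewrite -RintegralZl// /Rintegral fineK//; last first.
    exact: integrable_fin_num (integrableZl measurableT (f y) iec).
  apply: eq_integral => x _; rewrite /k /=; congr (_%:E).
  by rewrite (_ : 2 * pi * (y - xi) * x = 2 * pi * x * (y - xi)); ring.
have isg : mu.-integrable setT (EFin \o (fun y => F 1%N y * Num.sg (y - xi))).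
  exact: integrable_deriv_sg jF1.
have lim2 : (fun n => - \int[mu]_y (F 1%N y * (pi^-1 * atan ((2 * pi * (y - xi)) / dl n))))
   @ \oo --> - \int[mu]_y (2^-1 * (F 1%N y * Num.sg (y - xi))).
  apply: cvgN; apply: fine_cvg; rewrite fineK; last first.
    exact: integrable_fin_num (integrableZl measurableT 2^-1 isg).
  have cat n : continuous (fun y => pi^-1 * atan ((2 * pi * (y - xi)) / dl n)).
    move=> y; apply: cvgM; first exact: cvg_cst.
    apply: continuous_comp; last exact: continuous_atan.
    apply: cvgM; last exact: cvg_cst.
    apply: cvgM; first exact: cvg_cst.
    by apply: cvgB; [exact: cvg_id|exact: cvg_cst].
  apply: (@dominated_cvg _ _ _ mu setT measurableT _ _ (abse \o (EFin \o F 1%N))) => //.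
  - move=> n; apply/measurable_EFinP; apply: measurable_funM.
      by apply: continuous_measurable_fun; exact: jF1.1.
    by apply: continuous_measurable_fun; exact: cat.
  - move=> y _; apply: cvg_EFin; first exact: nearW.
    rewrite /comp /= mulrCA; apply: cvgM; first exact: cvg_cst.
    have -> : 2^-1 * Num.sg (y - xi) = pi^-1 * (Num.sg (2 * pi * (y - xi)) * (pi / 2)) :> R.
      rewrite !sgrM (gtr0_sg (_ : 0 < 2))// (gtr0_sg (pi_gt0 R)) !mul1r.
      by have := pi_gt0 R; move: (@pi R) => P P0; field; rewrite gt_eqF.
    apply: cvgM; first exact: cvg_cst.
    have := @cvg_atan_scale (2 * pi * (y - xi)).
    by under eq_fun do rewrite -[X in _ * X]invrK -/(dl _).
  - exact: integrable_abse (integrable_csupp jF1).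
  - move=> n y _; rewrite /= lee_fin normrM ler_piMr// normrM.
    rewrite ger0_norm ?invr_ge0 ?pi_ge0// ler_pdivrMl ?pi_gt0// mulr1.
    have := atan_gtNpi2 (2 * pi * (y - xi) / dl n).
    have := atan_ltpi2 (2 * pi * (y - xi) / dl n).
    have := pi_gt0 R; rewrite ler_norml.
    move: (@pi R) (atan _) => P a; lra.
have E : \int[mu]_x Re (h x) = - \int[mu]_y (2^-1 * (F 1%N y * Num.sg (y - xi))).
  apply: cvg_unique lim2 => //; apply: (cvg_trans _ lim1).
  apply: near_eq_cvg; near=> n.
  by rewrite fub (poisson_by_parts xi L0 (dl_gt0 n) jF0 jF1 (jF.1 0%N)).
rewrite -[LHS]/(\int[mu]_x Re (h x)) E RintegralZl//.
rewrite (Rintegral_deriv_sg xi jF0 jF1 (jF.1 0%N)).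
by rewrite /f; field.
Unshelve. all: by end_near. Qed.

End inversion.

(** * Integrals of complex functions and of tensor products *)

Section complex_integral.
Context {R : realType}.
Local Notation Re := (@complex.Re R).
Local Notation Im := (@complex.Im R).

Definition cmeasurable d (T : measurableType d) (f : T -> R[i]) :=
  measurable_fun setT (Re \o f) /\ measurable_fun setT (Im \o f).

Definition cintegrable d (T : measurableType d) (mu : {measure set T -> \bar R})
    (f : T -> R[i]) :=
  mu.-integrable setT (EFin \o (Re \o f)) /\ mu.-integrable setT (EFin \o (Im \o f)).

Lemma cintegrable_measurable d (T : measurableType d)
    (mu : {measure set T -> \bar R}) f : cintegrable mu f -> cmeasurable f.
Proof. by move=> [/measurable_int/measurable_EFinP ? /measurable_int/measurable_EFinP]. Qed.

Lemma cmeasurableM d (T : measurableType d) (f g : T -> R[i]) :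
  cmeasurable f -> cmeasurable g -> cmeasurable (fun x => f x * g x).
Proof.
move=> [fR fI] [gR gI]; split.
- rewrite (_ : _ \o _ = (fun x => Re (f x) * Re (g x) - Im (f x) * Im (g x))).
    by apply: measurable_funB; exact: measurable_funM.
  by apply/funext => x /=; case: (f x); case: (g x).
- rewrite (_ : _ \o _ = (fun x => Re (f x) * Im (g x) + Im (f x) * Re (g x))).
    by apply: measurable_funD; exact: measurable_funM.
  by apply/funext => x /=; case: (f x); case: (g x).
Qed.

Lemma cmeasurable_comp d d' (T : measurableType d) (U : measurableType d')
    (f : U -> R[i]) (g : T -> U) :
  cmeasurable f -> measurable_fun setT g -> cmeasurable (f \o g).
Proof. by move=> [fR fI] mg; split; [exact: (measurableT_comp fR mg)|exact: (measurableT_comp fI mg)]. Qed.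

Lemma cmeasurable_prod d (T : measurableType d) n (f : 'I_n -> T -> R[i]) :
  (forall j, cmeasurable (f j)) -> cmeasurable (fun x => \prod_j f j x).
Proof.
move=> mf; rewrite (_ : (fun x => _) = \prod_j f j); last first.
  by apply/funext => x; rewrite fct_prodE.
apply: (big_ind (@cmeasurable d T)).
- by split; exact: measurable_cst.
- by move=> g h; exact: cmeasurableM.
- by move=> j _; exact: mf.
Qed.

Lemma cintegralZ d (T : measurableType d) (mu : {measure set T -> \bar R})
    (c : R[i]) f : cintegrable mu f ->
  cintegrable mu (fun x => c * f x) /\
  cintegral mu (fun x => c * f x) = c * cintegral mu f.
Proof.
case: c => a b [iR iI].
have ZR z := integrableZl measurableT z iR.
have ZI z := integrableZl measurableT z iI.
have ER : EFin \o (Re \o (fun x => Complex a b * f x)) =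
   (fun x => (a * Re (f x))%:E - (b * Im (f x))%:E)%E.
  by apply/funext => x /=; case: (f x).
have EI : EFin \o (Im \o (fun x => Complex a b * f x)) =
   (fun x => (a * Im (f x))%:E + (b * Re (f x))%:E)%E.
  by apply/funext => x /=; case: (f x) => u v /=; rewrite -EFinD [b * _]mulrC; congr (_%:E); ring.
split.
  split; first by rewrite ER; apply: integrableB => //; [exact: ZR|exact: ZI].
  by rewrite EI; apply: integrableD => //; [exact: ZI|exact: ZR].
rewrite /cintegral; apply/eqP; rewrite eq_complex /=; apply/andP; split; apply/eqP.
- transitivity (\int[mu]_x (a * Re (f x) - b * Im (f x))).
    by apply: eq_Rintegral => x _; case: (f x).
  rewrite RintegralB//; [|exact: ZR|exact: ZI].
  by rewrite !RintegralZl.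
- transitivity (\int[mu]_x (a * Im (f x) + b * Re (f x))).
    by apply: eq_Rintegral => x _; case: (f x) => u v /=; rewrite [b * _]mulrC; ring.
  rewrite RintegralD//; [|exact: ZI|exact: ZR].
  by rewrite !RintegralZl.
Qed.

Lemma cintegral0 d (T : measurableType d) (mu : {measure set T -> \bar R}) :
  cintegrable mu (fun=> 0) /\ cintegral mu (fun=> 0) = 0.
Proof.
split; first by split; exact: integrable0.
by rewrite /cintegral /= Rintegral_cst//= mul0r.
Qed.

Lemma cintegralD d (T : measurableType d) (mu : {measure set T -> \bar R}) f g :
  cintegrable mu f -> cintegrable mu g ->
  cintegrable mu (fun x => f x + g x) /\
  cintegral mu (fun x => f x + g x) = cintegral mu f + cintegral mu g.
Proof.
move=> [fR fI] [gR gI].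
have ER : EFin \o (Re \o (fun x => f x + g x)) =
   (fun x => (Re (f x))%:E + (Re (g x))%:E)%E.
  by apply/funext => x /=; case: (f x); case: (g x).
have EI : EFin \o (Im \o (fun x => f x + g x)) =
   (fun x => (Im (f x))%:E + (Im (g x))%:E)%E.
  by apply/funext => x /=; case: (f x); case: (g x).
split.
  by split; [rewrite ER|rewrite EI]; apply: integrableD.
rewrite /cintegral; apply/eqP; rewrite eq_complex /=; apply/andP; split; apply/eqP.
- rewrite -RintegralD//.
  by apply: eq_Rintegral => x _; case: (f x); case: (g x).
- rewrite -RintegralD//.
  by apply: eq_Rintegral => x _; case: (f x); case: (g x).
Qed.

Lemma cintegral_sum d (T : measurableType d) (mu : {measure set T -> \bar R})
    (I : finType) (f : I -> T -> R[i]) : (forall i, cintegrable mu (f i)) ->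
  cintegral mu (fun x => \sum_i f i x) = \sum_i cintegral mu (f i).
Proof.
move=> fi; suff [] : cintegrable mu (fun x => \sum_i f i x) /\
  cintegral mu (fun x => \sum_i f i x) = \sum_i cintegral mu (f i) by [].
elim: (index_enum I) => [|i s [IH1 IH2]].
  have [H1 H2] := cintegral0 mu.
  rewrite (_ : (fun x => \sum_(i <- [::]) f i x) = fun=> 0); last first.
    by apply/funext => x; rewrite big_nil.
  by rewrite big_nil.
rewrite (_ : (fun x => _) = (fun x => f i x + \sum_(j <- s) f j x)); last first.
  by apply/funext => x; rewrite big_cons.
have [H1 H2] := cintegralD (fi i) IH1.
by split; rewrite // big_cons H2 IH2.
Qed.

Lemma cmeasurable_sum d (T : measurableType d) (I : finType) (f : I -> T -> R[i]) :
  (forall i, cmeasurable (f i)) -> cmeasurable (fun x => \sum_i f i x).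
Proof.
move=> mf; rewrite (_ : (fun x => _) = \sum_i f i); last first.
  by apply/funext => x; rewrite fct_sumE.
apply: (big_ind (@cmeasurable d T)).
- by split; exact: measurable_cst.
- move=> g h [gR gI] [hR hI]; split.
  + rewrite (_ : _ \o _ = (fun x => Re (g x) + Re (h x))).
      exact: measurable_funD.
    by apply/funext => x /=; rewrite fctE; case: (g x); case: (h x).
  + rewrite (_ : _ \o _ = (fun x => Im (g x) + Im (h x))).
      exact: measurable_funD.
    by apply/funext => x /=; rewrite fctE; case: (g x); case: (h x).
- by move=> i _; exact: mf.
Qed.

Lemma integral_prod_mul d1 d2 (T1 : measurableType d1) (T2 : measurableType d2)
    (m1 : {sigma_finite_measure set T1 -> \bar R})
    (m2 : {sigma_finite_measure set T2 -> \bar R}) (f : T1 -> R) (g : T2 -> R) :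
  m1.-integrable setT (EFin \o f) -> m2.-integrable setT (EFin \o g) ->
  (m1 \x m2)%E.-integrable setT (EFin \o (fun z => f z.1 * g z.2)) /\
  (\int[(m1 \x m2)%E]_z (f z.1 * g z.2) = (\int[m1]_x f x) * (\int[m2]_y g y)).
Proof.
move=> fi gi.
have mf : measurable_fun setT f by apply/measurable_EFinP/(measurable_int _ fi).
have mg : measurable_fun setT g by apply/measurable_EFinP/(measurable_int _ gi).
have mfg : measurable_fun setT (EFin \o (fun z : T1 * T2 => f z.1 * g z.2)).
  apply/measurable_EFinP; apply: measurable_funM.
    exact: measurableT_comp mf (@measurable_fst _ _ _ _).
  exact: measurableT_comp mg (@measurable_snd _ _ _ _).
have I : (m1 \x m2)%E.-integrable setT (EFin \o (fun z : T1 * T2 => f z.1 * g z.2)).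
  apply/(@integrable12ltyP _ _ _ _ _ m1 m2 _ mfg).
  have -> : (\int[m1]_x \int[m2]_y `|(f x * g y)%R%:E|)%E
     = ((\int[m1]_x `|(f x)%:E|) * (\int[m2]_y `|(g y)%:E|))%E.
    under eq_integral => x _.
      under eq_integral do rewrite EFinM abseM.
      rewrite ge0_integralZl//; last first.
        by apply/measurable_EFinP; exact: measurableT_comp.
      over.
    rewrite ge0_integralZr//.
    - by apply/measurable_EFinP; exact: measurableT_comp.
    - by apply: integral_ge0.
  have /integrableP[_ fy] := fi; have /integrableP[_ gy] := gi.
  by apply: lte_mul_pinfty => //; [exact: integral_ge0|rewrite ge0_fin_numE// integral_ge0].
split => //.
rewrite {1}/Rintegral -(integral12_prod_meas1 I) -RintegralZr//.
congr fine; apply: eq_integral => x _.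
rewrite /fubini_F EFinM /Rintegral fineK; last exact: integrable_fin_num.
by rewrite -integralZl.
Qed.

Lemma cintegral_prod_mul d1 d2 (T1 : measurableType d1) (T2 : measurableType d2)
    (m1 : {sigma_finite_measure set T1 -> \bar R})
    (m2 : {sigma_finite_measure set T2 -> \bar R}) (f : T1 -> R[i]) (g : T2 -> R[i]) :
  cintegrable m1 f -> cintegrable m2 g ->
  cintegrable (m1 \x m2)%E (fun z => f z.1 * g z.2) /\
  cintegral (m1 \x m2)%E (fun z => f z.1 * g z.2) = cintegral m1 f * cintegral m2 g.
Proof.
move=> [fR fI] [gR gI].
have [RR1 RR2] := integral_prod_mul fR gR.
have [II1 II2] := integral_prod_mul fI gI.
have [RI1 RI2] := integral_prod_mul fR gI.
have [IR1 IR2] := integral_prod_mul fI gR.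
have mk (u v : T1 * T2 -> R) w : (m1 \x m2)%E.-integrable setT (EFin \o u) ->
    (m1 \x m2)%E.-integrable setT (EFin \o v) -> 
    w =1 (u \- v) \/ w =1 (u \+ v) -> (m1 \x m2)%E.-integrable setT (EFin \o w).
  move=> iu iv [|] /funext ->; first exact: (integrableB measurableT iu iv).
  exact: (integrableD measurableT iu iv).
split; first split.
- by apply: (mk _ _ _ RR1 II1); left => x /=; case: (f x.1); case: (g x.2).
- by apply: (mk _ _ _ RI1 IR1); right => x /=; case: (f x.1); case: (g x.2).
rewrite /cintegral; apply/eqP; rewrite eq_complex /=; apply/andP; split; apply/eqP.
- rewrite -RR2 -II2 -RintegralB//.
  by apply: eq_Rintegral => x _; rewrite /=; case: (f x.1); case: (g x.2).
- rewrite -RI2 -IR2 -RintegralD//.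
  by apply: eq_Rintegral => x _; rewrite /=; case: (f x.1); case: (g x.2).
Qed.

(** Fubini's theorem for pure tensors, one coordinate at a time. *)
Lemma cintegral_tuple_prod n (h : 'I_n -> R -> R[i]) :
  (forall j, cintegrable (@lebesgue_measure R) (h j)) ->
  cintegrable (@lebesgue_measure_tuple R n) (fun t => \prod_j h j (tnth t j)) /\
  cintegral (@lebesgue_measure_tuple R n) (fun t => \prod_j h j (tnth t j)) =
  \prod_j cintegral (@lebesgue_measure R) (h j).
Proof.
elim: n h => [|n IH] h hi.
  have E1 : (fun t : 0.-tuple (measurableTypeR R) => \prod_(j < 0) h j (tnth t j)) = (fun=> 1).
    by apply/funext => t; rewrite big_ord0.
  rewrite E1 big_ord0; split.
    by split; apply: finite_measure_integrable_cst.
  rewrite /cintegral /= Rintegral_cst// Rintegral_cst//.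
  by rewrite mul0r mul1r [X in fine X](@diracT _ _ R [tuple]).
have [I1 I2] := IH _ (fun j => hi (lift ord0 j)).
have [P1 P2] := cintegral_prod_mul (hi ord0) I1.
pose F (t : n.+1.-tuple (measurableTypeR R)) := \prod_j h j (tnth t j).
have FE : F \o (@cons_pair R n) = (fun z => h ord0 z.1 * \prod_j h (lift ord0 j) (tnth z.2 j)).
  apply/funext => z; rewrite /F /= big_ord_recl; congr (_ * _).
  by apply: eq_bigr => j _; rewrite /cons_pair tnthS.
have mF : cmeasurable F.
  apply: cmeasurable_prod => j.
  apply: (cmeasurable_comp (cintegrable_measurable (hi j))).
  exact: measurable_tnth.
have mc := @measurable_cons_pair R n.
have [PR PI] := P1; rewrite -FE in PR PI.
have mRe : measurable_fun setT (EFin \o (Re \o F)) by apply/measurable_EFinP; case: mF.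
have mIm : measurable_fun setT (EFin \o (Im \o F)) by apply/measurable_EFinP; case: mF.
split.
  by split; apply: (integrable_pushforward mc).
have EX (f : n.+1.-tuple (measurableTypeR R) -> \bar R) : measurable_fun setT f ->
    (@lebesgue_measure R \x lebesgue_measure_tuple n)%E.-integrable setT (f \o @cons_pair R n) ->
    (\int[lebesgue_measure_tuple n.+1]_x f x =
     \int[(@lebesgue_measure R \x lebesgue_measure_tuple n)%E]_x (f \o @cons_pair R n) x)%E.
  by move=> mf If; exact: (integral_pushforward mc mf If measurableT).
rewrite big_ord_recl -I2 -P2 -FE /cintegral /Rintegral.
by rewrite (EX _ mRe PR) (EX _ mIm PI).
Qed.

End complex_integral.

(** * Wave packets at integer frequencies *)

Section packets.
Context {R : realType}.
Local Notation mu := (@lebesgue_measure R).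
Local Notation Re := (@complex.Re R).
Local Notation Im := (@complex.Im R).
Implicit Types (x y a L : R) (f : R -> R).

Lemma cexpiD x y : cexpi (x + y) = cexpi x * cexpi y :> R[i].
Proof.
by rewrite /cexpi cosD sinD [sin x * _ + _]addrC.
Qed.

Lemma cexpi0 : cexpi 0 = 1 :> R[i].
Proof. by rewrite /cexpi cos0 sin0. Qed.

Lemma cexpi_sum (I : finType) (F : I -> R) : cexpi (\sum_i F i) = \prod_i cexpi (F i).
Proof. exact: (big_morph cexpi cexpiD cexpi0). Qed.

Lemma Rintegral_itv_csupp f (b c : R) : continuous f ->
  (forall x, x <= b \/ c <= x -> f x = 0) ->
  \int[mu]_y f y = \int[mu]_(y in `[b, c]) f y.
Proof.
move=> cf f0; rewrite [RHS]Rintegral_mkcond; congr (Rintegral _ _ _).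
apply/funext => x; rewrite patchE; case: ifPn => // xbc; apply: f0.
have [xb|bx] := leP x b; [by left|have [cx|xc] := leP c x; [by right|]].
by move: xbc; rewrite notin_setE /= in_itv /= !ltW.
Qed.

Lemma Rintegral_translate L f a : 0 < L -> csupp L f ->
  \int[mu]_y f (y - a) = \int[mu]_y f y.
Proof.
move=> L0 [cf f0].
pose T y : R := y + a.
have dT y : is_derive y 1 T 1.
  rewrite (_ : T = id + cst a)//; apply: is_derive_eq; by rewrite addr0.
have T' : derive1 T = cst 1 by apply/funext => y; rewrite derive1E; apply: derive_val.
have cfa : continuous (fun y => f (y - a)).
  move=> y; apply: continuous_comp; last exact: cf.
  by apply: cvgB; [exact: cvg_id|exact: cvg_cst].
rewrite (@Rintegral_itv_csupp _ (- L + a) (L + a))//; last first.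
  move=> x [h|h]; apply: f0.
    by rewrite ler0_norm; lra.
  by rewrite ger0_norm; lra.
rewrite [RHS](@Rintegral_itv_csupp _ (- L) L)//; last first.
  move=> x [h|h]; apply: f0.
    by rewrite ler0_norm; lra.
  by rewrite ger0_norm; lra.
rewrite {1}/Rintegral (@integration_by_substitution_increasing R T (fun y => f (y - a)) (- L) L).
- congr fine; apply: eq_integral => y _.
  by rewrite T' /= fctE /= /T addrK mulr1.
- by lra.
- by move=> u v _ _ uv; rewrite /T ltrD2r.
- by rewrite T' => y _; exact: cvg_cst.
- by rewrite T'; exact: is_cvg_cst.
- by rewrite T'; exact: is_cvg_cst.
- have cT := is_derive_continuous dT.
  split=> [y _||]; first by case: (dT y).
    by apply: cvg_at_right_filter; exact: cT.
  by apply: cvg_at_left_filter; exact: cT.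
- exact: continuous_subspaceT.
Qed.

Lemma continuous_affine_trig (h : R -> R) (b a : R) : continuous h ->
  continuous (fun y : R => h (b * (y + a))).
Proof.
move=> ch y; apply: (@continuous_comp _ _ _ (fun y => b * (y + a)) h); last exact: ch.
apply: cvgM; first exact: cvg_cst.
by apply: cvgD; [exact: cvg_id|exact: cvg_cst].
Qed.

Lemma inv_fourier_translate L f a x : 0 < L -> csupp L f ->
  inv_fourier (fun y => f (y - a)) x = cexpi (2 * pi * x * a) * inv_fourier f x.
Proof.
move=> L0 cf.
have T (h : R -> R) : continuous h ->
   \int[mu]_y (f (y - a) * h (2 * pi * x * y)) =
   \int[mu]_y (f y * h (2 * pi * x * (y + a))).
  move=> ch.
  rewrite -(@Rintegral_translate L (fun y => f y * h (2 * pi * x * (y + a))) a)//.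
    by apply: eq_Rintegral => y _; rewrite subrK.
  by apply: csuppM => //; exact: continuous_affine_trig.
have ic (b : R) : mu.-integrable setT (EFin \o (fun y => b * (f y * cos (2 * pi * x * y)))).
  apply: (integrable_csupp (L := L)); apply: csuppZ; apply: csuppM => //.
  by apply: continuous_trig; exact: continuous_cos.
have is' (b : R) : mu.-integrable setT (EFin \o (fun y => b * (f y * sin (2 * pi * x * y)))).
  apply: (integrable_csupp (L := L)); apply: csuppZ; apply: csuppM => //.
  by apply: continuous_trig; exact: continuous_sin.
have ic1 : mu.-integrable setT (EFin \o (fun y => (f y * cos (2 * pi * x * y)))).
  apply: (integrable_csupp (L := L)); apply: csuppM => //.
  by apply: continuous_trig; exact: continuous_cos.
have is1 : mu.-integrable setT (EFin \o (fun y => (f y * sin (2 * pi * x * y)))).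
  apply: (integrable_csupp (L := L)); apply: csuppM => //.
  by apply: continuous_trig; exact: continuous_sin.
rewrite /inv_fourier (T _ (@continuous_cos R)) (T _ (@continuous_sin R)).
apply/eqP; rewrite eq_complex /=; apply/andP; split; apply/eqP.
- rewrite -!RintegralZl// -RintegralB//.
  by apply: eq_Rintegral => y _; rewrite mulrDr cosD; ring.
- rewrite -!RintegralZl// -RintegralD//.
  by apply: eq_Rintegral => y _; rewrite mulrDr sinD; ring.
Qed.

Lemma csupp0 L : csupp L (fun _ : R => 0 : R).
Proof. by split => // x; exact: cvg_cst. Qed.

Lemma csuppD L f g : csupp L f -> csupp L g -> csupp L (fun x => f x + g x).
Proof.
move=> [cf f0] [cg g0]; split => [x|x Lx]; last by rewrite f0// g0// addr0.
by apply: cvgD; [exact: cf|exact: cg].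
Qed.

Lemma inv_fourier_lincomb L (I : Type) (s : seq I) (c : I -> R) (F : I -> R -> R) x :
  (forall i, csupp L (F i)) ->
  csupp L (fun y => \sum_(i <- s) c i * F i y) /\
  inv_fourier (fun y => \sum_(i <- s) c i * F i y) x = \sum_(i <- s) (c i)%:C * inv_fourier (F i) x.
Proof.
move=> cF; elim: s => [|i s [IH1 IH2]].
  rewrite (_ : (fun y => _) = fun=> 0); last by apply/funext => y; rewrite big_nil.
  rewrite big_nil; split; first exact: csupp0.
  rewrite /inv_fourier (_ : (fun y => _) = cst 0) 1?(_ : (fun y => _ * sin _) = cst 0).
  - by rewrite Rintegral_cst// mul0r.
  - by apply/funext => y; rewrite mul0r.
  - by apply/funext => y; rewrite mul0r.
rewrite (_ : (fun y => _) = (fun y => c i * F i y + \sum_(i <- s) c i * F i y)); last first.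
  by apply/funext => y; rewrite big_cons.
rewrite big_cons -IH2; split.
  by apply: csuppD => //; exact: csuppZ.
have ic (G : R -> R) (h : R -> R) : csupp L G -> continuous h ->
    mu.-integrable setT (EFin \o (fun y => G y * h (2 * pi * x * y))).
  move=> cG ch; apply: (integrable_csupp (L := L)); apply: csuppM => //.
  exact: continuous_trig.
have E (h : R -> R) : continuous h ->
  \int[mu]_y ((c i * F i y + \sum_(i <- s) c i * F i y) * h (2 * pi * x * y)) =
  c i * (\int[mu]_y (F i y * h (2 * pi * x * y))) +
  \int[mu]_y ((\sum_(i <- s) c i * F i y) * h (2 * pi * x * y)).
  move=> ch; rewrite -RintegralZl//; last exact: ic.
  rewrite -RintegralD//.
  - by apply: eq_Rintegral => y _; ring.
  - exact: (integrableZl measurableT (c i) (ic _ _ (cF i) ch)).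
  - exact: ic.
rewrite /inv_fourier (E _ (@continuous_cos R)) (E _ (@continuous_sin R)).
by apply/eqP; rewrite eq_complex /= !mul0r subr0 addr0 !eqxx.
Qed.

Lemma jet_bump : jet 1 (@bump_derivn R).
Proof.
split=> [k x|k x x1]; first exact: is_derive_bump.
apply: bump_out; apply/negP => /andP[x0 x1'].
by move: x1; rewrite ger0_norm ?(ltW x0)// leNgt x1'.
Qed.

Lemma csupp_bump_sqr : csupp 1 (fun y : R => bump_derivn 0 y ^+ 2).
Proof.
have [cb b0] := jet_csupp 0 jet_bump.
by split=> [y|y /b0 ->]; [rewrite /continuous_at !expr2; apply: cvgM; exact: cb|rewrite expr0n].
Qed.

(** The integers of [[-N, N)] are indexed by an ordinal type, to be summed over. *)
Definition box_point (N : nat) (u : 'I_(N.*2)) : int := (u : nat)%:Z - N%:Z.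

Lemma box_point_inj N : injective (@box_point N).
Proof. by move=> u v /addIr [] /val_inj. Qed.

Lemma box_point_bounds N u : - N%:Z <= @box_point N u < N%:Z.
Proof. have := ltn_ord u; rewrite /box_point; lia. Qed.

Lemma box_point_surj N (l : int) : - N%:Z <= l < N%:Z -> exists u, @box_point N u = l.
Proof.
move=> lN; have h : (`|(l + N%:Z)%R|%N < N.*2)%N by lia.
by exists (Ordinal h); rewrite /box_point /=; lia.
Qed.

Lemma bump_floor k x (l : int) : bump_derivn k (x - l%:~R) != 0 -> Num.floor x = l.
Proof.
move=> b0; apply: floor_def.
have /andP[h1 h2] : (0 < x - l%:~R) && (x - l%:~R < 1).
  by apply: contraNT b0 => h; rewrite bump_out.
by rewrite intrD; apply/andP; split; lra.
Qed.

(** The [k]-th derivative of the sum of the bumps in the intervals [[l, l+1]],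
[-N <= l < N], with coefficients [c l]. *)
Definition packet_sum N (c : int -> R) k x : R :=
  \sum_(u < N.*2) c (box_point u) * bump_derivn k (x - (box_point u)%:~R).

Lemma is_derive_shift f f' (a x : R) : (forall y : R, is_derive y 1 f (f' y)) ->
  is_derive x 1 (fun y => f (y - a)) (f' (x - a)).
Proof.
move=> df.
have d1 : is_derive x 1 (fun y => y - a) 1.
  rewrite (_ : (fun y => _) = id - cst a)//; apply: is_derive_eq; by rewrite subr0.
have := @is_derive1_comp R f (fun y => y - a) x _ _ (df (x - a)) d1.
by rewrite mulr1.
Qed.

Lemma jet_shift_bump N (u : 'I_(N.*2)) :
  jet (N%:R + 1) (fun k x => bump_derivn k (x - (box_point u)%:~R)).
Proof.
split=> [k x|k x Nx].
  by apply: (@is_derive_shift (bump_derivn k) (bump_derivn k.+1)) => y; exact: is_derive_bump.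
apply: (jet_bump.2).
have /andP[l1 l2] := box_point_bounds u.
have h1 : - N%:R <= (box_point u)%:~R :> R.
  by rewrite -[N%:R]/(N%:Z%:~R) -rmorphN ler_int.
have h2 : (box_point u)%:~R < N%:R :> R.
  by rewrite -[N%:R]/(N%:Z%:~R) ltr_int.
move: Nx h1 h2; move: (_%:~R : R) (N%:R : R) => l M.
rewrite !ler_normr; case/orP => h h1 h2; apply/orP; [left|right]; lra.
Qed.

Lemma jet_packet_sum N c : jet (N%:R + 1) (packet_sum N c).
Proof.
split=> [k x|k x Nx]; last first.
  by apply: big1 => u _; rewrite (jet_shift_bump u).2// mulr0.
rewrite (_ : packet_sum N c k = \sum_(u < N.*2) (cst (c (box_point u)) * (fun y => bump_derivn k (y - (box_point u)%:~R)))); last first.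
  by apply/funext => y; rewrite fct_sumE.
apply: is_derive_sum => u.
have := (jet_shift_bump u).1 k x => d1.
by apply: is_derive_eq; rewrite /GRing.scale /= mulr0 addr0.
Qed.

Definition expsum N (c : int -> R) x : R[i] :=
  \sum_(u < N.*2) (c (box_point u))%:C * cexpi (2 * pi * x * (box_point u)%:~R).

(** Translating a bump by an integer modulates its transform, so the packet is an
exponential sum times one fixed function. *)
Lemma inv_fourier_packet_sum N c x :
  inv_fourier (packet_sum N c 0) x = expsum N c x * inv_fourier (bump_derivn 0) x.
Proof.
have cb u : csupp (N%:R + 1) (fun x => bump_derivn 0 (x - (@box_point N u)%:~R)).
  exact: (jet_csupp 0 (jet_shift_bump u)).
have [_ ->] := inv_fourier_lincomb (index_enum _) (fun u => c (box_point u)) x cb.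
rewrite /expsum mulr_suml; apply: eq_bigr => u _.
by rewrite (inv_fourier_translate _ _ ltr01 (jet_csupp 0 jet_bump)) mulrA.
Qed.

Lemma schwartz_inv_fourier_packet_sum N c : schwartz (inv_fourier (packet_sum N c 0)).
Proof. by apply: (schwartz_inv_fourier _ (jet_packet_sum N c)); rewrite ltr_wpDl. Qed.

Lemma fourier_inv_fourier_packet_sum N c y :
  fourier (inv_fourier (packet_sum N c 0)) y = (packet_sum N c 0 y)%:C.
Proof. by rewrite (fourier_inv_fourier _ _ (jet_packet_sum N c)) // ltr_wpDl. Qed.

End packets.

(** * Symbols supported in lattice cubes *)

Section symbol.
Context {R : realType} (n : nat).
Local Notation mu := (@lebesgue_measure R).
Local Notation Re := (@complex.Re R).
Local Notation Im := (@complex.Im R).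
Local Notation normc := (@Normc.normc R).
Implicit Types (eps : ('I_n -> int) -> R) (k : 'I_n -> nat) (eta : 'rV[R]_n).

(** The derivative of order [k] of the symbol with value [eps l] times a product of bumps on
the cube [l + [0,1]^n]. *)
Definition lattice_symbol eps k eta : R :=
  eps (fun j => Num.floor (eta 0 j)) *
  \prod_j bump_derivn (k j) (eta 0 j - (Num.floor (eta 0 j))%:~R).

Definition lattice_symbol_box N eps k eta : R :=
  \sum_(u : {ffun 'I_n -> 'I_(N.*2)})
     eps (fun j => box_point (u j)) * \prod_j bump_derivn (k j) (eta 0 j - (box_point (u j))%:~R).

(** Near any point the symbol is a finite sum of smooth functions. *)
Lemma lattice_symbol_local N eps k eta : (forall j, `|eta 0 j| < N%:R) ->
  lattice_symbol eps k eta = lattice_symbol_box N eps k eta.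
Proof.
move=> etaN.
have /fin_all_exists [u0 Hu0] : forall j : 'I_n, exists u : 'I_(N.*2), box_point u = Num.floor (eta 0 j).
  move=> j; apply: box_point_surj; have := etaN j; rewrite ltr_norml => /andP[h1 h2].
  apply/andP; split.
    by rewrite floor_ge_int rmorphN ltW.
  by rewrite floor_lt_int.
rewrite /lattice_symbol_box (bigD1 (finfun u0))//= [X in _ = _ + X]big1 ?addr0.
  rewrite /lattice_symbol; congr (_ * _).
    by congr eps; apply/funext => j; rewrite ffunE Hu0.
  by apply: eq_bigr => j _; rewrite ffunE Hu0.
move=> u uu0; have [|/forallPn [j uj]] := boolP [forall j, u j == u0 j].
  move=> /forallP H; case/negP: uu0; apply/eqP/ffunP => j; rewrite ffunE.
  exact/eqP.
rewrite (bigD1 j)//= (_ : bump_derivn _ _ = 0) ?mul0r ?mulr0//.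
apply/eqP; apply: contraNT uj => /bump_floor H.
by apply/eqP/(@box_point_inj N); rewrite Hu0 H.
Qed.

Definition incr_order k (i : 'I_n) : 'I_n -> nat := fun j => ((j == i) + k j)%N.

Lemma is_derive_dir0 (f : 'rV[R]_n -> R) (a v : 'rV[R]_n) :
  (forall h, f (h *: v + a) = f a) -> is_derive a v f 0.
Proof.
move=> fh.
have H : h^-1 *: ((f \o shift a) (h *: v) - f a) @[h --> 0^'] --> (0 : R).
  under eq_fun do rewrite /= fh subrr scaler0.
  exact: cvg_cst.
by split; [apply/cvg_ex; exists 0|rewrite /derive; apply/cvg_lim].
Qed.

Lemma is_derive_coord (g g' : R -> R) i eta :
  (forall x : R, is_derive x 1 g (g' x)) ->
  is_derive eta (delta_mx 0 i) (fun eta => g (eta 0 i)) (g' (eta 0 i)).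
Proof.
move=> dg; have [gd ge] := dg (eta 0 i).
have FE : (fun h : R => h^-1 *: (((fun eta : 'rV[R]_n => g (eta 0 i)) \o shift eta)
      (h *: delta_mx 0 i) - g (eta 0 i))) =
    (fun h : R => h^-1 *: ((g \o shift (eta 0 i)) (h *: 1) - g (eta 0 i))).
  apply/funext => h; rewrite /= !mxE !eqxx mulr1.
  by rewrite -[h *: 1]/(h * 1) mulr1.
by split; [rewrite /derivable FE|rewrite /derive FE].
Qed.

Lemma is_derive_lattice_symbol_box N eps k i eta :
  is_derive eta (delta_mx 0 i) (lattice_symbol_box N eps k) (lattice_symbol_box N eps (incr_order k i) eta).
Proof.
have Eh h j : j != i -> (h *: delta_mx 0 i + eta : 'rV[R]_n) 0 j = eta 0 j.
  by move=> ji; rewrite !mxE (negbTE ji) andbF mulr0 add0r.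
pose t (u : {ffun 'I_n -> 'I_(N.*2)}) (eta : 'rV[R]_n) :=
  eps (fun j => box_point (u j)) * \prod_j bump_derivn (k j) (eta 0 j - (box_point (u j))%:~R).
have dt u : is_derive eta (delta_mx 0 i) (t u)
  (eps (fun j => box_point (u j)) * \prod_j bump_derivn (incr_order k i j) (eta 0 j - (box_point (u j))%:~R)).
  pose q (eta : 'rV[R]_n) := eps (fun j => box_point (u j)) *
    \prod_(j | j != i) bump_derivn (k j) (eta 0 j - (box_point (u j))%:~R).
  have dq : is_derive eta (delta_mx 0 i) q 0.
    apply: is_derive_dir0 => h; rewrite /q; congr (_ * _).
    by apply: eq_bigr => j ji; rewrite Eh.
  have db := @is_derive_coord (fun x => bump_derivn (k i) (x - (box_point (u i))%:~R))
     (fun x => bump_derivn (k i).+1 (x - (box_point (u i))%:~R)) i eta (fun x =>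
     @is_derive_shift R (bump_derivn (k i)) (bump_derivn (k i).+1) _ x (is_derive_bump (k i))).
  rewrite (_ : t u = q * (fun eta => bump_derivn (k i) (eta 0 i - (box_point (u i))%:~R))); last first.
    by apply/funext => y; rewrite /t (bigD1 i)//= mulrA mulrAC.
  apply: is_derive_eq; rewrite /GRing.scale /= mulr0 addr0.
  rewrite (bigD1 i)//= /incr_order eqxx add1n /q mulrA mulrAC; congr (_ * _ * _).
  by apply: eq_bigr => j /negbTE ->; rewrite add0n.
pose tt (m : 'I_#|{ffun 'I_n -> 'I_(N.*2)}|) := t (enum_val m).
rewrite (_ : lattice_symbol_box N eps k = \sum_m tt m); last first.
  apply/funext => y; rewrite fct_sumE /lattice_symbol_box (reindex _ (onW_bij _ (enum_val_bij _))).
  by apply: eq_bigr.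
have -> : lattice_symbol_box N eps (incr_order k i) eta = \sum_(m < #|{ffun 'I_n -> 'I_(N.*2)}|)
    (eps (fun j => box_point (enum_val m j)) *
       \prod_j bump_derivn (incr_order k i j) (eta 0 j - (box_point (enum_val m j))%:~R)).
  by rewrite /lattice_symbol_box (reindex _ (onW_bij _ (enum_val_bij _))).
by apply: is_derive_sum => m; exact: dt.
Qed.

Lemma continuous_lattice_symbol_box N eps k : continuous (lattice_symbol_box N eps k).
Proof.
have cM (f g : 'rV[R]_n -> R) : continuous f -> continuous g -> continuous (f * g).
  by move=> cf cg eta; exact: (continuousM (cf eta) (cg eta)).
have cD (f g : 'rV[R]_n -> R) : continuous f -> continuous g -> continuous (f + g).
  by move=> cf cg eta; exact: (continuousD (cf eta) (cg eta)).
have cst_c (a : R) : continuous (cst a : 'rV[R]_n -> R) by exact: cst_continuous.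
rewrite (_ : lattice_symbol_box N eps k = \sum_(u : {ffun 'I_n -> 'I_(N.*2)})
    (cst (eps (fun j => box_point (u j))) *
      \prod_j (fun eta : 'rV[R]_n => bump_derivn (k j) (eta 0 j - (box_point (u j))%:~R)))); last first.
  by apply/funext => y; rewrite fct_sumE; apply: eq_bigr => u _; rewrite fctE fct_prodE.
apply: (big_ind (fun f : 'rV[R]_n -> R => continuous f)); [exact: cst_c|exact: cD|move=> u _].
apply: (cM _ _ (cst_c _)).
apply: (big_ind (fun f : 'rV[R]_n -> R => continuous f)); [exact: cst_c|exact: cM|move=> j _ eta].
apply: (@continuous_comp _ _ _ (fun eta : 'rV[R]_n => eta 0 j)
   (fun x => bump_derivn (k j) (x - (box_point (u j))%:~R))); first exact: coord_continuous.
exact: (is_derive_continuous (fun x =>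
     @is_derive_shift R (bump_derivn (k j)) (bump_derivn (k j).+1) _ x (is_derive_bump (k j)))).
Qed.

Lemma near_box eta : exists N : nat,
  \forall y \near eta, forall j, `|(y : 'rV[R]_n) 0 j| < N%:R.
Proof.
pose A := \sum_j `|eta 0 j|; exists (Num.bound A).
have A0 : 0 <= A by apply: sumr_ge0.
apply: (@filter_forall _ _ (fun j => [set y : 'rV[R]_n | `|y 0 j| < (Num.bound A)%:R]) (nbhs eta)) => j.
have : `|eta 0 j| < (Num.bound A)%:R.
  apply: le_lt_trans (archi_boundP A0).
  by rewrite /A (bigD1 j)//= lerDl sumr_ge0.
have : (fun y : 'rV[R]_n => `|y 0 j|) @ eta --> `|eta 0 j|.
  exact: cvg_norm (@coord_continuous R 1 n 0 j eta).
by move=> /cvgr_lt; apply.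
Qed.

Lemma is_derive_lattice_symbol eps k i eta :
  is_derive eta (delta_mx 0 i) (lattice_symbol eps k) (lattice_symbol eps (incr_order k i) eta).
Proof.
have [N HN] := near_box eta.
rewrite (@lattice_symbol_local N eps _ eta (nbhs_singleton HN)).
apply: near_eq_is_derive (is_derive_lattice_symbol_box N eps k i eta).
by near=> y; rewrite (@lattice_symbol_local N)//; near: y.
Unshelve. all: by end_near. Qed.

Lemma continuous_lattice_symbol eps k : continuous (lattice_symbol eps k).
Proof.
move=> eta; have [N HN] := near_box eta.
rewrite /continuous_at (@lattice_symbol_local N eps _ eta (nbhs_singleton HN)).
have H := @continuous_lattice_symbol_box N eps k eta.
apply: (cvg_trans (@near_eq_cvg _ _ (nbhs eta) _ _ _ _) H).
by apply: filterS HN => y Hy; rewrite (@lattice_symbol_local N).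
Qed.

Definition clattice_symbol eps k eta : R[i] := (lattice_symbol eps k eta)%:C.

Lemma Re_clattice_symbol eps k : Re \o clattice_symbol eps k = lattice_symbol eps k.
Proof. by []. Qed.

Lemma Im_clattice_symbol eps k : Im \o clattice_symbol eps k = cst 0.
Proof. by []. Qed.

Lemma cpartials_clattice_symbol eps s :
  cpartials s (clattice_symbol eps (fun=> 0%N)) = clattice_symbol eps (fun j => count_mem j s).
Proof.
elim: s => [|i s IH] //=.
rewrite /cpartials /= -/(cpartials s _) IH; apply/funext => eta.
rewrite /cpartial Re_clattice_symbol Im_clattice_symbol (@derive_val _ _ _ _ _ _ _ (is_derive_lattice_symbol _ _ i eta)) derive_cst.
rewrite /clattice_symbol; congr ((lattice_symbol _ _ _)%:C); apply/funext => j.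
by rewrite /incr_order eq_sym.
Qed.

Lemma smooth_clattice_symbol eps (U : set 'rV[R]_n) : smooth_on U (clattice_symbol eps (fun=> 0%N)).
Proof.
move=> s eta _; rewrite cpartials_clattice_symbol Re_clattice_symbol Im_clattice_symbol; split.
- exact: continuous_lattice_symbol.
- exact: cst_continuous.
- move=> i; split; last exact: derivable_cst.
  by case: (is_derive_lattice_symbol eps (fun j => count_mem j s) i eta).
Qed.

Lemma bump_bounded (m : nat) : exists C : R, 0 <= C /\ forall x : R, `|bump_derivn m x| <= C.
Proof.
have [C [C0 HC]] := @bump_le_sqr R m; exists C; split => // x.
have [/andP[x0 x1]|xout] := boolP ((0 < x) && (x < 1)); last first.
  by rewrite bump_out// normr0.
apply: (le_trans (HC _ x0 x1)); rewrite ler_piMr// exprn_ile1//.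
  by rewrite mulr_ge0; lra.
by rewrite mulr_ile1; lra.
Qed.

Lemma lattice_symbol_bounded eps k : (forall l, `|eps l| <= 1) ->
  exists C, 0 <= C /\ forall eta, `|lattice_symbol eps k eta| <= C.
Proof.
move=> e1.
have /fin_all_exists [C HC] := fun j => bump_bounded (k j).
exists (\prod_j C j); split.
  by apply: prodr_ge0 => j _; case: (HC j).
move=> eta; rewrite /lattice_symbol normrM -[leRHS]mul1r ler_pM// normr_prod.
apply: ler_prod => j _; rewrite normr_ge0 /=; by have [_ ->] := HC j.
Qed.

Lemma normc_real (x : R) : normc x%:C = `|x|.
Proof. by rewrite /= expr0n addr0 sqrtr_sqr. Qed.

(** Where the symbol is nonzero, the corner of the cube lies in [G], so the distance to
[G] is at most the diameter [sqrt n] of the cube, and bounded derivatives are all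
that is needed. *)
Lemma mhm_clattice_symbol M (G : {vspace 'rV[R]_n}) eps : (forall l, `|eps l| <= 1) ->
  (forall l, eps l != 0 -> (\row_j (l j)%:~R : 'rV[R]_n) \in G) ->
  (forall eta, eta \notin G -> 0 < dist_subspace eta G) ->
  mhm_symbol M G (clattice_symbol eps (fun=> 0%N)).
Proof.
move=> e1 eG dG.
split; [|exact: smooth_clattice_symbol|].
  have [C [_ HC]] := lattice_symbol_bounded (fun=> 0%N) e1.
  by exists C => eta; rewrite /clattice_symbol normc_real.
move=> g _; rewrite /multi_partial cpartials_clattice_symbol.
set k := (X in clattice_symbol eps X); set s := (\sum_i g i)%N.
have [C [C0 HC]] := lattice_symbol_bounded k e1.
pose D : R := Num.sqrt n%:R.
exists (C * D ^+ s) => eta etaG; have d0 := dG _ etaG.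
rewrite /clattice_symbol normc_real.
have [e0|e0] := eqVneq (eps (fun j => Num.floor (eta 0 j))) 0.
  rewrite /lattice_symbol e0 mul0r normr0 mulr_ge0 ?mulr_ge0 ?exprn_ge0 ?sqrtr_ge0//.
  by rewrite invr_ge0 exprn_ge0// ltW.
apply: (le_trans (HC eta)); rewrite -mulrA ler_peMr// -exprVn -exprMn.
rewrite exprn_ege1// ler_pdivlMr// mul1r.
apply: (@le_trans _ _ (euclidean_norm (eta - \row_j (Num.floor (eta 0 j))%:~R))).
  apply: ge_inf; last by exists (\row_j (Num.floor (eta 0 j))%:~R) => //; exact: eG.
  by exists 0 => _ [v _ <-]; exact: sqrtr_ge0.
rewrite /euclidean_norm /D ler_wsqrtr//.
rewrite -[n in n%:R]card_ord -sumr_const; apply: ler_sum => j _.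
rewrite !mxE; have /andP[h1 h2] := floor_itv (eta 0 j).
rewrite exprn_ile1//; first by rewrite subr_ge0.
by move: h2; rewrite intrD; lra.
Qed.

Lemma realCM (a b : R) : (a * b)%:C = a%:C * b%:C.
Proof. exact: (rmorphM (real_complex R)). Qed.

Lemma realC_prod (I : finType) (F : I -> R) : (\prod_i F i)%:C = \prod_i (F i)%:C.
Proof. exact: (rmorph_prod (real_complex R)). Qed.

Lemma realC_sum (I : finType) (F : I -> R) : (\sum_i F i)%:C = \sum_i (F i)%:C.
Proof. exact: (rmorph_sum (real_complex R)). Qed.

(** The cubes have disjoint interiors, so the symbol times the transforms of the packets
is a finite sum of pure tensors, each of which integrates to a modulation of one
fixed function. *)
Lemma multiplier_op_clattice_symbol N eps (c : 'I_n -> int -> R) x :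
  multiplier_op (clattice_symbol eps (fun=> 0%N)) (fun j => inv_fourier (packet_sum N (c j) 0)) x =
  (\sum_(u : {ffun 'I_n -> 'I_(N.*2)})
    (eps (fun j => box_point (u j)) * \prod_j c j (box_point (u j)))%:C *
     cexpi (2 * pi * x * (\sum_j box_point (u j))%:~R)) *
  inv_fourier (fun y => bump_derivn 0 y ^+ 2) x ^+ n.
Proof.
rewrite /multiplier_op.
pose w (u : {ffun 'I_n -> 'I_(N.*2)}) := eps (fun j => box_point (u j)) * \prod_j c j (box_point (u j)).
pose b (l : int) (y : R) : R[i] := (bump_derivn 0 (y - l%:~R) ^+ 2)%:C * cexpi (2 * pi * x * y).
have E t : clattice_symbol eps (fun=> 0%N) (\row_j tnth t j) *
    (\prod_j fourier (inv_fourier (packet_sum N (c j) 0)) (tnth t j)) *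
    cexpi (2 * pi * x * \sum_j tnth t j) =
    \sum_u (w u)%:C * \prod_j b (box_point (u j)) (tnth t j).
  under [X in _ * X * _]eq_bigr do rewrite fourier_inv_fourier_packet_sum.
  rewrite -realC_prod /packet_sum bigA_distr_bigA /clattice_symbol -realCM mulr_sumr realC_sum mulr_suml.
  apply: eq_bigr => u _.
  rewrite big_split /= /b big_split /= mulr_sumr -realC_prod [RHS]mulrA -realCM cexpi_sum.
  congr (_%:C * _).
  rewrite prodrXl; set c' := \prod_j c j _; rewrite /w -/c'.
  have [b0|/prodf_neq0 b0] := eqVneq (\prod_j bump_derivn 0 (tnth t j - (box_point (u j))%:~R)) 0.
    by rewrite b0 expr0n /= !mulr0.
  have fl j : Num.floor (tnth t j) = box_point (u j) by apply: bump_floor (b0 j _).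
  have -> : lattice_symbol eps (fun=> 0%N) (\row_j tnth t j) =
    eps (fun j => box_point (u j)) * \prod_j bump_derivn 0 (tnth t j - (box_point (u j))%:~R).
    rewrite /lattice_symbol; congr (_ * _).
      by congr eps; apply/funext => j; rewrite mxE fl.
    by apply: eq_bigr => j _; rewrite mxE fl.
  ring.
rewrite (_ : (fun t => _) = (fun t => \sum_u (w u)%:C * \prod_j b (box_point (u j)) (tnth t j))); last first.
  by apply/funext => t; exact: E.
have cb2 := @csupp_bump_sqr R.
have cbl (l : int) : csupp (`|l|%:~R + 1) (fun y : R => bump_derivn 0 (y - l%:~R) ^+ 2).
  split=> [y|y yl].
    apply: (@continuous_comp _ _ _ (fun y : R => y - l%:~R) (fun y => bump_derivn 0 y ^+ 2)); last exact: cb2.1.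
    by apply: cvgB; [exact: cvg_id|exact: cvg_cst].
  apply: cb2.2; rewrite intr_norm in yl.
  have H : `|y| <= `|y - l%:~R| + `|l%:~R : R| by rewrite -{1}[y](subrK l%:~R) ler_normD.
  by move: (le_trans yl H); rewrite addrC lerD2r.
have bint l : cintegrable mu (b l).
  split.
  - rewrite (_ : _ \o _ = EFin \o (fun y => bump_derivn 0 (y - l%:~R) ^+ 2 * cos (2 * pi * x * y))).
      apply: integrable_csupp (csuppM (cbl l) _).
      by apply: continuous_trig; exact: continuous_cos.
    by apply/funext => y; rewrite /= mul0r subr0.
  - rewrite (_ : _ \o _ = EFin \o (fun y => bump_derivn 0 (y - l%:~R) ^+ 2 * sin (2 * pi * x * y))).
      apply: integrable_csupp (csuppM (cbl l) _).
      by apply: continuous_trig; exact: continuous_sin.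
    by apply/funext => y; rewrite /= mul0r addr0.
have bval l : cintegral mu (b l) = cexpi (2 * pi * x * l%:~R) * inv_fourier (fun y => bump_derivn 0 y ^+ 2) x.
  rewrite -(@inv_fourier_translate R 1 (fun y => bump_derivn 0 y ^+ 2) l%:~R x ltr01 cb2).
  rewrite /cintegral /inv_fourier; congr Complex; apply: eq_Rintegral => y _ /=.
    by rewrite mul0r subr0.
  by rewrite mul0r addr0.
have tp (u : {ffun 'I_n -> 'I_(N.*2)}) := cintegral_tuple_prod (fun j => bint (box_point (u j))).
rewrite cintegral_sum; last first.
  by move=> u; exact: (cintegralZ (w u)%:C (tp u).1).1.
rewrite mulr_suml; apply: eq_bigr => u _.
rewrite (cintegralZ (w u)%:C (tp u).1).2 (tp u).2 -/(w u) -mulrA; congr (_ * _).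
under eq_bigr do rewrite bval.
rewrite big_split /= prodr_const card_ord -cexpi_sum -mulr_sumr.
by rewrite rmorph_sum.
Qed.

End symbol.

(** * Rudin-Shapiro polynomials *)

Section rudin_shapiro.
Context {R : realType}.
Local Notation normc := (@Normc.normc R).
Implicit Types (b : bool) (s m N : nat) (z : R[i]) (x : R).

(** Coefficients of the Rudin-Shapiro pair [P_(s+1) = P_s + z^(2^s) Q_s],
[Q_(s+1) = P_s - z^(2^s) Q_s]; [true] stands for [P] and [false] for [Q]. *)
Fixpoint rscoef b s m : R :=
  if s is t.+1 then
    if (m < 2 ^ t)%N then rscoef true t m
    else (if b then 1 else -1) * rscoef false t (m - 2 ^ t)%N
  else 1.

Lemma rscoef_sqr b s m : rscoef b s m ^+ 2 = 1.
Proof.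
elim: s b m => [|s IH] b m /=; first by rewrite expr1n.
by case: ifP => // _; rewrite exprMn IH mulr1; case: b; rewrite ?sqrrN expr1n.
Qed.

Lemma normr_rscoef b s m : `|rscoef b s m| = 1.
Proof.
apply/eqP; rewrite -(@eqrXn2 _ 2)// ?normr_ge0//.
by rewrite real_normK ?num_real// rscoef_sqr expr1n.
Qed.

Definition rspoly b s z : R[i] := \sum_(m < 2 ^ s) (rscoef b s m)%:C * z ^+ m.

Lemma rspolyS b s z : rspoly b s.+1 z =
  rspoly true s z + (if b then 1 else -1) * (z ^+ (2 ^ s) * rspoly false s z).
Proof.
rewrite /rspoly expnS mul2n -addnn big_split_ord /=; congr (_ + _).
  by apply: eq_bigr => m _; rewrite ltn_ord.
rewrite !mulr_sumr; apply: eq_bigr => m _.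
rewrite ltnNge leq_addr /= addKn exprD realCM.
have -> : (if b then 1 else -1 : R)%:C = (if b then 1 else -1 : R[i]).
  by case: b => //; rewrite (rmorphN1 (real_complex R)).
by rewrite -mulrA; congr (_ * _); rewrite mulrCA.
Qed.

Lemma sqr_normc (z : R[i]) : normc z ^+ 2 = complex.Re z ^+ 2 + complex.Im z ^+ 2.
Proof. by case: z => u v; rewrite normcE sqr_sqrtr// addr_ge0// sqr_ge0. Qed.

Lemma normc_ge0 (z : R[i]) : 0 <= normc z.
Proof. by case: z => u v; rewrite normcE sqrtr_ge0. Qed.

Lemma parallelogram (z w : R[i]) :
  normc (z + w) ^+ 2 + normc (z - w) ^+ 2 = 2 * (normc z ^+ 2 + normc w ^+ 2).
Proof. by rewrite !sqr_normc; case: z => a b; case: w => c d /=; ring. Qed.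

Lemma normcX z m : normc z = 1 -> normc (z ^+ m) = 1.
Proof.
move=> z1; elim: m => [|m IH]; first by rewrite expr0 Normc.normc1.
by rewrite exprS Normc.normcM z1 IH mulr1.
Qed.

(** The parallelogram law propagates the identity through the recursion. *)
Lemma rspoly_pair s z : normc z = 1 ->
  normc (rspoly true s z) ^+ 2 + normc (rspoly false s z) ^+ 2 = 2 * 2 ^+ s.
Proof.
move=> z1; elim: s => [|s IH].
  have E b : rspoly b 0 z = 1 by rewrite /rspoly big_ord1 expr0 mulr1.
  by rewrite !E Normc.normc1; ring.
rewrite !rspolyS mul1r mulN1r parallelogram Normc.normcM normcX// mul1r IH.
by rewrite exprS.
Qed.

Lemma rspoly_le s z : normc z = 1 -> normc (rspoly true s z) ^+ 2 <= 2 * 2 ^+ s.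
Proof. by move=> z1; rewrite -(rspoly_pair s z1) lerDl sqr_ge0. Qed.

(** The [2^s] Rudin-Shapiro signs placed at the integers [a + sg m], and 0 elsewhere. *)
Definition packet_coef (a sg : int) s (l : int) : R :=
  \sum_(m < 2 ^ s) (l == a + sg * (m : nat)%:Z)%:R * rscoef true s m.

Lemma packet_coef_val a sg s m : sg != 0 -> (m < 2 ^ s)%N ->
  packet_coef a sg s (a + sg * m%:Z) = rscoef true s m.
Proof.
move=> sg0 ms; rewrite /packet_coef (bigD1 (Ordinal ms))//= eqxx mul1r big1 ?addr0//.
move=> k km; rewrite (_ : (_ == _) = false) ?mul0r//.
apply: contraNF km => /eqP /addrI /(mulfI sg0) [h].
by apply/eqP/val_inj.
Qed.

Lemma packet_coef_neq0 a sg s l : packet_coef a sg s l != 0 ->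
  exists2 m, (m < 2 ^ s)%N & l = a + sg * m%:Z.
Proof.
move=> h; have [/existsP [m /eqP ->]|/existsPn H] :=
  boolP [exists m : 'I_(2 ^ s), l == a + sg * (m : nat)%:Z].
  by exists m.
case/negP: h; apply/eqP; apply: big1 => m _.
by rewrite (negbTE (H m)) mul0r.
Qed.

Lemma normr_packet_coef a sg s l : sg != 0 -> `|packet_coef a sg s l| <= 1.
Proof.
move=> sg0; have [->|h] := eqVneq (packet_coef a sg s l) 0; first by rewrite normr0.
by have [m ms ->] := packet_coef_neq0 h; rewrite packet_coef_val// normr_rscoef.
Qed.

Lemma cexpiX (y : R) m : cexpi y ^+ m = cexpi (y * m%:R) :> R[i].
Proof.
elim: m => [|m IH]; first by rewrite expr0 mulr0 cexpi0.
by rewrite exprSr IH -cexpiD -natr1 mulrDr mulr1.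
Qed.

Lemma expsum_packet_coef N a sg s x :
  (forall m, (m < 2 ^ s)%N -> - N%:Z <= a + sg * m%:Z < N%:Z) ->
  expsum N (packet_coef a sg s) x =
  cexpi (2 * pi * x * a%:~R) * rspoly true s (cexpi (2 * pi * x * sg%:~R)).
Proof.
move=> bd; rewrite /expsum /packet_coef /rspoly mulr_sumr.
under eq_bigr do rewrite realC_sum mulr_suml.
rewrite exchange_big /=; apply: eq_bigr => m _.
have [u0 Hu0] := box_point_surj (bd m (ltn_ord m)).
rewrite (bigD1 u0)//= Hu0 eqxx mul1r big1 ?addr0.
  rewrite mulrCA cexpiX -cexpiD; congr (_ * cexpi _).
  by rewrite intrD intrM mulrDr mulrA.
move=> u uu0; rewrite (_ : (_ == _) = false) ?mul0r ?mul0r//.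
apply: contraNF uu0 => /eqP h; apply/eqP/(@box_point_inj N).
by rewrite Hu0.
Qed.

Lemma normc_expsum_packet_coef N a sg s x :
  (forall m, (m < 2 ^ s)%N -> - N%:Z <= a + sg * m%:Z < N%:Z) ->
  normc (expsum N (packet_coef a sg s) x) ^+ 2 <= 2 * 2 ^+ s.
Proof.
move=> bd; rewrite expsum_packet_coef// Normc.normcM normc_cexpi mul1r.
by apply: rspoly_le; exact: normc_cexpi.
Qed.

End rudin_shapiro.

(** * Lattice points of the hyperplane *)

Section lattice_points.
Context {R : realType} (m : nat).
Local Notation n := m.+4.
Local Notation normc := (@Normc.normc R).
Implicit Types (b : bool) (s : nat) (l : 'I_n -> int) (x : R).

(** The coordinates from the third on; they are free, and determine the first two together
with the output frequency. *)
Definition tail_index (i : 'I_m.+2) : 'I_n := lift ord0 (lift ord0 i).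
(** The first two coordinates range up to a multiple of [2^s] that depends on the dimension;
[2 ^ extra_scale] is larger than this multiple. *)
Definition extra_scale : nat := 2 + 2 * (m + 4) ^ 2.

(** The shift of the third coordinate into [[2^s, 2^(s+1))] is what lets [block_scale]
recover [s]. *)
Definition block_offset s (j : 'I_n) : int := if j == 2%N :> nat then (2 ^ s)%N%:Z else 0.
(** In the lattice points used below the second coordinate is nonpositive and all others
are nonnegative. *)
Definition block_sign (j : 'I_n) : int := if j == 1%N :> nat then -1 else 1.
Definition block_size s (j : 'I_n) : nat := if (j < 2)%N then (s + extra_scale)%N else s.
Definition block_coef s (j : 'I_n) : int -> R :=
  packet_coef (block_offset s j) (block_sign j) (block_size s j).

Definition block_scale l : nat := trunc_log 2 `|l (tail_index ord0)|%N.

(** The product of the [block_coef] cancels the signs of the test functions of the scale to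
which [l] belongs; the sign of the output frequency is left. *)
Definition sign_coef b l : R :=
  ((\sum_(j < n) (j.+1)%:Z * l j == 0) && (0 <= \sum_j l j < (2 ^ block_scale l)%N%:Z))%:R *
  \prod_j block_coef (block_scale l) j (l j) * rscoef b (block_scale l) (absz (\sum_j l j)).

Lemma block_sign_neq0 j : block_sign j != 0.
Proof. by rewrite /block_sign; case: ifP. Qed.

Lemma normr_sign_coef b l : `|sign_coef b l| <= 1.
Proof.
rewrite /sign_coef !normrM normr_rscoef mulr1 -[leRHS]mulr1 ler_pM//.
  by rewrite ger0_norm// lern1 leq_b1.
rewrite normr_prod -[leRHS](@big1_eq R 1 *%R 'I_n (index_enum _) xpredT).
by apply: ler_prod => j _; rewrite normr_ge0 normr_packet_coef ?block_sign_neq0.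
Qed.

Lemma sign_coef_neq0 b l : sign_coef b l != 0 -> \sum_(j < n) (j.+1)%:Z * l j = 0 :> int.
Proof.
move=> e0; apply/eqP; apply: contraNT e0 => /negbTE w0.
by rewrite /sign_coef w0 !mul0r.
Qed.

(** The solution of [sum_j l_j = k], [sum_j (j+1) l_j = 0] with prescribed free coordinates. *)
Definition lattice_point s (k : 'I_(2 ^ s)) (t : {ffun 'I_m.+2 -> 'I_(2 ^ s)}) : 'I_n -> int :=
  let r i := (t i : nat)%:Z + block_offset s (tail_index i) in
  let A := \sum_i r i in let B := \sum_(i < m.+2) (i : nat)%:Z * r i in
  fun j => if unlift ord0 j is Some j' then
             if unlift ord0 j' is Some i then r i
             else - (k : nat)%:Z - B - 2 * A
           else 2 * (k : nat)%:Z + B + A.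

Lemma sum_split (F : 'I_n -> int) :
  \sum_j F j = F ord0 + F (lift ord0 ord0) + \sum_i F (tail_index i).
Proof. by rewrite !big_ord_recl addrA. Qed.

Lemma weighted_split l : \sum_(j < n) (j.+1)%:Z * l j =
  l ord0 + 2 * l (lift ord0 ord0) +
  (\sum_(i < m.+2) (i : nat)%:Z * l (tail_index i) + 3 * \sum_i l (tail_index i)).
Proof.
rewrite sum_split mul1r; congr (_ + _).
rewrite mulr_sumr -big_split /=; apply: eq_bigr => i _.
by rewrite -mulrDl /= /fintype.bump; congr (_ * _); lia.
Qed.

Lemma lattice_point_tail s k t i :
  @lattice_point s k t (tail_index i) = (t i : nat)%:Z + block_offset s (tail_index i).
Proof. by rewrite /lattice_point /tail_index !liftK. Qed.

Lemma lattice_point_sum s k t : \sum_j @lattice_point s k t j = (k : nat)%:Z.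
Proof.
rewrite sum_split; under eq_bigr do rewrite lattice_point_tail.
rewrite /lattice_point unlift_none liftK unlift_none.
move: (\sum_i _) (\sum_(i < _) _ * _) => A B; lia.
Qed.

Lemma lattice_point_weighted s k t : \sum_(j < n) (j.+1)%:Z * @lattice_point s k t j = 0.
Proof.
rewrite weighted_split.
under eq_bigr do rewrite lattice_point_tail.
under [X in _ + 3 * X]eq_bigr do rewrite lattice_point_tail.
rewrite /lattice_point unlift_none liftK unlift_none.
move: (\sum_i _) (\sum_(i < _) _ * _) => A B; lia.
Qed.

Lemma lattice_point_unique s (k : 'I_(2 ^ s)) (t : {ffun 'I_m.+2 -> 'I_(2 ^ s)}) l :
  (forall i, l (tail_index i) = (t i : nat)%:Z + block_offset s (tail_index i)) ->
  \sum_j l j = (k : nat)%:Z -> \sum_(j < n) (j.+1)%:Z * l j = 0 -> l = @lattice_point s k t.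
Proof.
move=> lt; rewrite sum_split weighted_split.
have EA : \sum_i l (tail_index i) = \sum_i ((t i : nat)%:Z + block_offset s (tail_index i)).
  by apply: eq_bigr => i _; rewrite lt.
have EB : \sum_(i < m.+2) (i : nat)%:Z * l (tail_index i) =
    \sum_(i < m.+2) (i : nat)%:Z * ((t i : nat)%:Z + block_offset s (tail_index i)).
  by apply: eq_bigr => i _; rewrite lt.
rewrite EA EB.
move=> H1 H2; apply/funext => j; rewrite /lattice_point.
case: (unliftP ord0 j) => [j' ->|->].
  case: (unliftP ord0 j') => [i ->|->]; first exact: lt.
  move: H1 H2; move: (\sum_i _) (\sum_(i < _) _ * _) => A B; lia.
move: H1 H2; move: (\sum_i _) (\sum_(i < _) _ * _) => A B; lia.
Qed.

Lemma block_offset_bounds s j : 0 <= block_offset s j <= (2 ^ s)%N%:Z.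
Proof. by rewrite /block_offset; case: ifP => _; lia. Qed.

(** With [S = 2^s], the free coordinates are at most [2S], so the first two are at most
[2S + (m+4)(m+2) 2S] in absolute value. *)
Lemma lattice_point_range s (k : 'I_(2 ^ s)) (t : {ffun 'I_m.+2 -> 'I_(2 ^ s)}) j :
  exists2 q, (q < 2 ^ block_size s j)%N &
  @lattice_point s k t j = block_offset s j + block_sign j * q%:Z.
Proof.
pose r i := (t i : nat)%:Z + block_offset s (tail_index i).
have r0 i : 0 <= r i by have := block_offset_bounds s (tail_index i); rewrite /r; lia.
have r1 i : r i <= 2 * (2 ^ s)%N%:Z.
  by have := block_offset_bounds s (tail_index i); have := ltn_ord (t i); rewrite /r; lia.
pose A := \sum_i r i; pose B := \sum_(i < m.+2) (i : nat)%:Z * r i.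
have A0 : 0 <= A by apply: sumr_ge0.
have B0 : 0 <= B by apply: sumr_ge0 => i _; rewrite mulr_ge0.
have A1 : A <= (m.+2)%:Z * (2 * (2 ^ s)%N%:Z).
  apply: (@le_trans _ _ (\sum_(i < m.+2) 2 * (2 ^ s)%N%:Z)); first by apply: ler_sum.
  by rewrite sumr_const card_ord -[leLHS]mulr_natl natz.
have B1 : B <= (m.+2)%:Z * A.
  rewrite /A mulr_sumr; apply: ler_sum => i _; rewrite ler_wpM2r//.
  by have := ltn_ord i; lia.
have extra1 : (2 + 2 * (m + 4) ^ 2 <= 2 ^ extra_scale)%N by exact: ltnW (ltn_expl _ _).
have S0 : (0 < 2 ^ s)%N by rewrite expn_gt0.
have K : 2 * (2 ^ s)%N%:Z + B + 2 * A <= (2 ^ (s + extra_scale))%N%:Z.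
  rewrite expnD.
  have : ((2 ^ s) * (2 + 2 * (m + 4) ^ 2) <= 2 ^ s * 2 ^ extra_scale)%N by rewrite leq_mul2l extra1 orbT.
  move: (2 ^ s)%N (2 ^ extra_scale)%N S0 A1 => S K S0 A1 H.
  have H2 : (m.+2)%:Z * A <= (m.+2)%:Z * ((m.+2)%:Z * (2 * S%:Z)) by rewrite ler_wpM2l.
  apply: (@le_trans _ _ ((S * (2 + 2 * (m + 4) ^ 2))%N%:Z)); last by lia.
  nia.
have kS := ltn_ord k.
rewrite /lattice_point -/r; case: (unliftP ord0 j) => [j' ->|->].
  case: (unliftP ord0 j') => [i ->|->].
    exists (t i); first exact: ltn_ord.
    by rewrite /block_sign /= mul1r addrC.
  exists (absz ((k : nat)%:Z + B + 2 * A)).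
    rewrite /block_size /= -/(r _) -/A -/B in K *; lia.
  rewrite /block_offset /block_sign /= -/A -/B; lia.
exists (absz (2 * (k : nat)%:Z + B + A)).
  rewrite /block_size /= -/A -/B in K *; lia.
rewrite /block_offset /block_sign /= -/A -/B; lia.
Qed.

Lemma block_range_box s j q : (q < 2 ^ block_size s j)%N ->
  - (2 ^ (s + extra_scale))%N%:Z <= block_offset s j + block_sign j * q%:Z < (2 ^ (s + extra_scale))%N%:Z.
Proof.
rewrite /block_size /block_offset /block_sign.
have S0 : (0 < 2 ^ s)%N by rewrite expn_gt0.
have K : (2 * 2 ^ s <= 2 ^ (s + extra_scale))%N.
  rewrite expnD mulnC leq_mul2l; apply/orP; right.
  by rewrite -{1}(expn1 2) leq_exp2l.
by case: (nat_of_ord j) => [|[|[|?]]] /=;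
  move: (2 ^ (s + extra_scale))%N (2 ^ s)%N S0 K => K S S0 SK; lia.
Qed.

Lemma block_scale_range s l q : (q < 2 ^ s)%N -> l (tail_index ord0) = (2 ^ s)%N%:Z + q%:Z ->
  block_scale l = s.
Proof.
move=> qs E; rewrite /block_scale E; apply: trunc_log_eq => //.
by rewrite expnS; lia.
Qed.

(** The lattice points that contribute are parametrised bijectively by the output frequency
and the [m+2] free coordinates, and each contributes the sign of its frequency. *)
Lemma lattice_sum b s x :
  \sum_(u : {ffun 'I_n -> 'I_((2 ^ (s + extra_scale)).*2)})
    (sign_coef b (fun j => box_point (u j)) * \prod_j block_coef s j (box_point (u j)))%:C *
     cexpi (2 * pi * x * (\sum_j box_point (u j))%:~R) =
  ((2 ^ s) ^ m.+2)%N%:R * rspoly b s (cexpi (2 * pi * x)).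
Proof.
set N := (2 ^ (s + extra_scale))%N.
have S0 : (0 < 2 ^ s)%N by rewrite expn_gt0.
pose T := ('I_(2 ^ s) * {ffun 'I_m.+2 -> 'I_(2 ^ s)})%type.
have [psi Hpsi] : exists psi : T -> {ffun 'I_n -> 'I_(N.*2)},
    forall kt j, box_point (psi kt j) = lattice_point kt.1 kt.2 j.
  apply: (@fin_all_exists T (fun=> {ffun 'I_n -> 'I_(N.*2)})
    (fun kt u => forall j, box_point (u j) = lattice_point kt.1 kt.2 j)) => -[k t] /=.
  have /fin_all_exists [u Hu] : forall j, exists u : 'I_(N.*2), box_point u = lattice_point k t j.
    move=> j; have [q qs ->] := lattice_point_range k t j.
    exact/box_point_surj/block_range_box.
  by exists (finfun u) => j; rewrite ffunE.
have psiE kt : (fun j => box_point (psi kt j)) = lattice_point kt.1 kt.2 by exact/funext/Hpsi.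
have psi_inj : injective psi.
  move=> [k t] [k' t'] E.
  have E' : lattice_point k t = lattice_point k' t' by rewrite -(psiE (k, t)) -(psiE (k', t')) E.
  have kk : k = k'.
    by apply: val_inj; have := lattice_point_sum k t; rewrite E' lattice_point_sum => -[].
  congr pair => //; apply/ffunP => i; apply: val_inj.
  have := lattice_point_tail k t i; rewrite E' lattice_point_tail => /addIr [].
  by [].
have val kt : sign_coef b (fun j => box_point (psi kt j)) * \prod_j block_coef s j (box_point (psi kt j)) =
    rscoef b s kt.1.
  rewrite psiE /sign_coef; case: kt => k t /=.
  have sc : block_scale (lattice_point k t) = s.
    apply: (@block_scale_range _ _ (t ord0)); first exact: ltn_ord.
    by rewrite lattice_point_tail /block_offset /= addrC.
  rewrite sc lattice_point_weighted eqxx lattice_point_sum ltz_nat ltn_ord /= mul1r.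
  rewrite mulrAC -big_split /= big1 ?mul1r// => j _.
  have [q qs E] := lattice_point_range k t j.
  by rewrite (Hpsi (k, t)) /block_coef E packet_coef_val ?block_sign_neq0// -expr2 rscoef_sqr.
(* a nonzero coefficient forces the scale of the point to be [s] *)
have out u : u \notin psi @: (predT : pred T) ->
    sign_coef b (fun j => box_point (u j)) * \prod_j block_coef s j (box_point (u j)) = 0.
  move=> uout; apply/eqP; apply: contraNT uout.
  rewrite mulf_eq0 negb_or => /andP[e0 /prodf_neq0 c0].
  have /fin_all_exists2 [q qs Eq] : forall j, exists2 q, (q < 2 ^ block_size s j)%N &
      box_point (u j) = block_offset s j + block_sign j * q%:Z.
    by move=> j; exact: packet_coef_neq0 (c0 j isT).
  pose l j := box_point (u j).
  have lt i : l (tail_index i) = (q (tail_index i))%:Z + block_offset s (tail_index i).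
    by rewrite /l Eq addrC /block_sign /= mul1r.
  have sc : block_scale l = s.
    apply: (@block_scale_range _ _ (q (tail_index ord0))); first exact: (qs (tail_index ord0)).
    by rewrite lt /block_offset /= addrC.
  have qt i : (q (tail_index i) < 2 ^ s)%N by exact: (qs (tail_index i)).
  have w0 := sign_coef_neq0 e0.
  have : 0 <= \sum_j l j < (2 ^ s)%N%:Z.
    move: e0; rewrite /sign_coef -/l sc; case: (0 <= \sum_j l j < _) => //.
    by rewrite andbF !mul0r eqxx.
  move=> /andP[k0 k1].
  have kS : (absz (\sum_j l j)%R < 2 ^ s)%N by lia.
  pose t := [ffun i => Ordinal (qt i)].
  apply/imsetP; exists (Ordinal kS, t); rewrite ?inE//.
  apply/ffunP => j; apply/(@box_point_inj N); rewrite Hpsi /=.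
  rewrite -[LHS]/(l j); congr (_ j); apply: lattice_point_unique => //.
    by move=> i; rewrite lt ffunE.
  by rewrite /= gez0_abs.
rewrite (bigID (mem (psi @: (predT : pred T)))) /= [X in _ + X]big1 ?addr0; last first.
  by move=> u /out ->; rewrite mul0r.
rewrite big_imset /=; last by move=> ? ? _ _; exact: psi_inj.
transitivity (\sum_(kt : T) (rscoef b s kt.1)%:C * cexpi (2 * pi * x) ^+ kt.1).
  rewrite [LHS](eq_bigl xpredT); last by [].
  apply: eq_bigr => kt _; rewrite val; congr (_ * _).
  rewrite cexpiX; congr (cexpi (_ * _)).
  by under eq_bigr do rewrite Hpsi; rewrite lattice_point_sum.
rewrite -(pair_bigA _ (fun (k : 'I_(2 ^ s)) (_ : {ffun 'I_m.+2 -> 'I_(2 ^ s)}) =>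
   (rscoef b s k)%:C * cexpi (2 * pi * x) ^+ k)) /=.
rewrite /rspoly mulr_sumr; apply: eq_bigr => k _.
by rewrite sumr_const card_ffun !card_ord -[LHS]mulr_natl.
Qed.

End lattice_points.

(** * The non-degenerate hyperplane *)

Section hyperplane.
Context {R : realType} (n : nat).
Implicit Types (eta v : 'rV[R]_n.+1).

Definition normal_col : 'cV[R]_n.+1 := \col_j (j.+1)%:R.

Definition normal_form : 'Hom('rV[R]_n.+1, 'M[R]_(1, 1)) :=
  linfun (mulmxr normal_col).

Definition weight_hyperplane : {vspace 'rV[R]_n.+1} := lker normal_form.

Lemma mem_weight_hyperplane eta :
  (eta \in weight_hyperplane) = (\sum_(j < n.+1) (j.+1)%:R * eta 0 j == 0).
Proof.
rewrite memv_ker /normal_form lfunE /=; apply/eqP/eqP => [/matrixP/(_ 0 0)|H].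
  rewrite !mxE => H; rewrite -[RHS]H.
  by apply: eq_bigr => k _; rewrite mxE mulrC.
apply/matrixP => i j; rewrite !ord1 !mxE -[RHS]H.
by apply: eq_bigr => k _; rewrite mxE mulrC.
Qed.

Lemma dim_weight_hyperplane : \dim weight_hyperplane = n.
Proof.
have := limg_ker_dim normal_form fullv.
rewrite capfv -/weight_hyperplane dimvf /dim /= mul1n.
suff -> : \dim (normal_form @: fullv) = 1%N by rewrite addn1 => -[].
apply/eqP; rewrite eqn_leq; apply/andP; split.
  by have := dimvS (subvf (normal_form @: fullv)); rewrite dimvf /dim /= mul1n.
rewrite lt0n dimv_eq0; apply/eqP => H.
have : normal_form (delta_mx 0 0) \in (normal_form @: fullv)%VS.
  by rewrite memv_img// memvf.
rewrite H memv0 /normal_form lfunE /= => /eqP /matrixP/(_ 0 0).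
rewrite !mxE (bigD1 ord0)//= !mxE !eqxx mul1r big1 ?addr0 => [/eqP|j j0].
  by rewrite oner_eq0.
by rewrite !mxE (negbTE j0) andbF mul0r.
Qed.

(** The coefficients of the equation of the hyperplane in the [n+2] extended coordinates. *)
Definition ext_weight (j : 'I_n.+2) : R := if unlift ord_max j is Some q then (q.+1)%:R else 0.

Lemma ext_weight_inj : injective ext_weight.
Proof.
move=> i j; rewrite /ext_weight; case: (unliftP ord_max i) => [p ->|->];
  case: (unliftP ord_max j) => [q ->|->] //.
- by move/eqP; rewrite eqr_nat => /eqP [] /val_inj ->.
- by move/eqP; rewrite pnatr_eq0.
- by move/eqP; rewrite eq_sym pnatr_eq0.
Qed.

Lemma sum_ext (F : 'I_n.+2 -> R) :
  \sum_j F j = \sum_(q < n.+1) F (lift ord_max q) + F ord_max.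
Proof.
rewrite big_ord_recr /=; congr (_ + _); apply: eq_bigr => q _; congr F.
by apply: val_inj; rewrite /= /fintype.bump leqNgt ltn_ord.
Qed.

Lemma ext_coord_lift eta q : ext_coord eta (lift ord_max q) = eta 0 q.
Proof. by rewrite /ext_coord liftK. Qed.

Lemma ext_coord_max eta : ext_coord eta ord_max = - \sum_i eta 0 i.
Proof. by rewrite /ext_coord unlift_none. Qed.

Lemma sum_ext_coord eta : \sum_j ext_coord eta j = 0.
Proof.
rewrite sum_ext ext_coord_max; under eq_bigr do rewrite ext_coord_lift.
by rewrite subrr.
Qed.

Lemma sum_weight_ext_coord eta : eta \in weight_hyperplane ->
  \sum_j ext_weight j * ext_coord eta j = 0.
Proof.
rewrite mem_weight_hyperplane => /eqP H; rewrite sum_ext {2}/ext_weight unlift_none mul0r addr0 -[RHS]H.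
by apply: eq_bigr => q _; rewrite ext_coord_lift /ext_weight liftK.
Qed.

(** The extended coordinates satisfy two linear relations, with all coefficients 1 and with
distinct coefficients; two unknowns are determined by these. *)
Lemma two_coords_inj eta (p q : 'I_n.+2) : eta \in weight_hyperplane -> p != q ->
  (forall j, j != p -> j != q -> ext_coord eta j = 0) -> eta = 0.
Proof.
move=> eG pq e0.
have S1 := sum_ext_coord eta; have S2 := sum_weight_ext_coord eG.
have qp : q != p by rewrite eq_sym.
move: S1; rewrite (bigD1 p)//= (bigD1 q)//= big1 ?addr0; last first.
  by move=> j /andP[jp jq]; exact: e0.
move=> S1.
move: S2; rewrite (bigD1 p)//= (bigD1 q)//= big1 ?addr0; last first.
  by move=> j /andP[jp jq]; rewrite e0// mulr0.
have -> : ext_coord eta q = - ext_coord eta p by apply/eqP; rewrite -addr_eq0 addrC S1.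
rewrite mulrN -mulrBl => /eqP; rewrite mulf_eq0 subr_eq0 (inj_eq ext_weight_inj) (negbTE pq) /=.
move=> /eqP ep; have eq : ext_coord eta q = 0 by move: S1; rewrite ep add0r.
apply/rowP => j; rewrite mxE -ext_coord_lift.
have [->//|jp] := eqVneq (lift ord_max j) p.
by have [->//|jq] := eqVneq (lift ord_max j) q; exact: e0.
Qed.

Definition ext_mx d (i : 'I_d -> 'I_n.+2) : 'M[R]_(n.+1, d) :=
  \matrix_(p, a) (if unlift ord_max (i a) is Some q then (p == q)%:R else -1).

Lemma ext_mxE d (i : 'I_d -> 'I_n.+2) eta :
  eta *m ext_mx i = \row_a ext_coord eta (i a).
Proof.
apply/rowP => a; rewrite !mxE /ext_coord.
under eq_bigr do rewrite mxE.
case: (unlift ord_max (i a)) => [q|].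
  rewrite (bigD1 q)//= eqxx mulr1 big1 ?addr0// => j jq.
  by rewrite (negbTE jq) mulr0.
by rewrite -sumrN; apply: eq_bigr => j _; rewrite mulrN1.
Qed.

(** The selected coordinates omit exactly two indices, so the projection is injective;
equality of dimensions gives surjectivity. *)
Lemma nondegenerate_weight_hyperplane : nondegenerate_subspace weight_hyperplane.
Proof.
move=> i imono.
have iinj : injective i.
  move=> a b ab; apply: val_inj; case: (ltngtP a b) => // /imono; by rewrite ab ltnn.
have [p [q [pq Cpq]]] : exists p q, p != q /\ (~: (i @: predT) = [set p; q])%SET.
  have : #|(~: (i @: predT))%SET| == 2%N.
    have := cardsC (i @: predT); rewrite card_ord.
    have -> : #|(i @: predT)%SET| = n by rewrite card_imset// card_ord; exact: dim_weight_hyperplane.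
    move=> H.
    by rewrite -(eqn_add2l n) H addn2.
  by move=> /finset.cards2P [p [q [pq ->]]]; exists p, q.
pose f := linfun (mulmxr (ext_mx i) \o (vsval : subvs_of weight_hyperplane -> 'rV[R]_n.+1)).
have fE (y : subvs_of weight_hyperplane) : f y = \row_a ext_coord (vsval y) (i a) by rewrite lfunE /= ext_mxE.
have f0 : lker f == 0%VS.
  apply/lker0P => y z yz; have {yz} uv : f (y - z) = 0 by rewrite linearB /= yz subrr.
  rewrite fE in uv; apply/eqP; rewrite -subr_eq0; apply/eqP/val_inj.
  rewrite [RHS](linear0 (vsval : subvs_of weight_hyperplane -> _)).
  apply: (two_coords_inj (subvsP _) pq) => j jp jq.
  have : j \notin [set p; q]%SET by rewrite !inE negb_or jp jq.
  rewrite -Cpq inE negbK => /imsetP [a _ ->].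
  by have /rowP/(_ a) := uv; rewrite !mxE.
have fT : limg f = fullv.
  apply/eqP; rewrite eqEdim subvf /= limg_dim_eq; last by rewrite (eqP f0) capv0.
  by rewrite !dimvf /dim /= mul1n.
apply: (@eq_bij _ _ f) => [|y]; last by rewrite fE.
exists (f^-1)%VF; first exact: lker0_lfunK.
by move=> y; apply: limg_lfunVK; rewrite fT memvf.
Qed.

Lemma coord_le_norm eta j : `|eta 0 j| <= euclidean_norm eta.
Proof.
rewrite /euclidean_norm -sqrtr_sqr ler_wsqrtr// (bigD1 j)//= lerDl.
by apply: sumr_ge0 => k _; exact: sqr_ge0.
Qed.

Lemma dist_weight_hyperplane_gt0 eta : eta \notin weight_hyperplane ->
  0 < dist_subspace eta weight_hyperplane.
Proof.
move=> eG; pose c := `|\sum_(j < n.+1) (j.+1)%:R * eta 0 j|.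
have c0 : 0 < c by rewrite normr_gt0 -mem_weight_hyperplane.
pose W : R := \sum_(j < n.+1) (j.+1)%:R.
have W0 : 0 < W.
  by rewrite /W big_ord_recl ltr_wpDr// sumr_ge0.
apply: (@lt_le_trans _ _ (c / W)); first by rewrite divr_gt0.
apply: lb_le_inf; first by exists (euclidean_norm (eta - 0)), 0 => //; exact: mem0v.
move=> _ [v /= vG <-]; rewrite ler_pdivrMr// /c.
have /eqP v0 : \sum_(j < n.+1) (j.+1)%:R * v 0 j == 0 by rewrite -mem_weight_hyperplane.
have -> : \sum_(j < n.+1) (j.+1)%:R * eta 0 j =
    \sum_(j < n.+1) (j.+1)%:R * (eta - v) 0 j.
  apply/eqP; rewrite -subr_eq0 -sumrB -[X in _ == X]v0; apply/eqP/eq_bigr => j _.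
  by rewrite !mxE; ring.
apply: (le_trans (ler_norm_sum _ _ _)); rewrite /W mulr_sumr.
apply: ler_sum => j _; rewrite normrM mulrC normr_nat ler_wpM2r//.
exact: coord_le_norm.
Qed.

End hyperplane.

(** * Norm estimates *)

Section norms.
Context {R : realType}.
Local Notation mu := (@lebesgue_measure R).
Local Notation normc := (@Normc.normc R).
Local Notation Re := (@complex.Re R).
Local Notation Im := (@complex.Im R).
Implicit Types (f g : R -> R[i]) (x : R).

Lemma measurable_normc f : cmeasurable f -> measurable_fun setT (normc \o f).
Proof.
move=> [mR mI].
rewrite (_ : normc \o f = Num.sqrt \o (fun x => Re (f x) ^+ 2 + Im (f x) ^+ 2)).
  apply: measurableT_comp.
    by apply: continuous_measurable_fun; exact: sqrt_continuous.
  by apply: measurable_funD; exact: measurable_funX.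
by apply/funext => x /=; case: (f x).
Qed.

Lemma continuous_cmeasurable f : continuous (Re \o f) -> continuous (Im \o f) ->
  cmeasurable f.
Proof. by split; exact: continuous_measurable_fun. Qed.

(** For finite [q >= 1] the [q]-th power of [1/(1+x^2)] is at most [1/(1+x^2)], which is integrable;
for infinite [q] the supremum is at 0. *)
Lemma cLnorm_decay (q : \bar R) : (1 < q)%E -> exists K : R, 0 <= K /\
  forall (G : R) f, 0 <= G -> measurable_fun setT (normc \o f) ->
    (forall x, normc (f x) <= G / (1 + x ^+ 2)) -> (cLnorm mu q f <= (G * K)%:E)%E.
Proof.
have d1 x : 1 <= 1 + x ^+ 2 by rewrite lerDl sqr_ge0.
have d0 x : 0 < 1 + x ^+ 2 by exact: lt_le_trans (d1 x).
case: q => [r|_|//]; last first.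
  exists 1; split => // G f G0 mf Hf; rewrite mulr1 /cLnorm unlock.
  case: ifPn => // _.
  apply/ess_supP; apply: aeW => x /=.
  rewrite lee_fin ger0_norm ?normc_ge0//; apply: (le_trans (Hf x)).
  by rewrite ler_pdivrMr// ler_peMr.
rewrite lte_fin => r1; have r0 : 0 < r by exact: lt_trans r1.
pose I : R := \int[mu]_x (1 + x ^+ 2)^-1.
have I0 : 0 <= I by apply: Rintegral_ge0 => x _; rewrite invr_ge0 ltW.
exists (I `^ r^-1); split; first exact: powR_ge0.
move=> G f G0 mf Hf; rewrite /cLnorm unlock.
have -> : (G * I `^ r^-1)%:E = ((G `^ r * I)%:E `^ r^-1)%E.
  by rewrite poweR_EFin powRM ?powR_ge0// -powRrM mulfV ?gt_eqF// powRr1.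
apply: gt0_ler_poweR.
- by rewrite invr_ge0 ltW.
- rewrite in_itv /= leey andbT; apply: integral_ge0 => x _.
  by rewrite lee_fin powR_ge0.
- by rewrite in_itv /= leey andbT lee_fin mulr_ge0// powR_ge0.
have iI := @integrable_oneDsqrV R.
have -> : (G `^ r * I)%:E = (\int[mu]_x (G `^ r * (1 + x ^+ 2)^-1)%:E)%E.
  rewrite -[RHS]fineK; last exact: integrable_fin_num (integrableZl measurableT (G `^ r) iI).
  by rewrite -RintegralZl.
apply: ge0_le_integral => //.
- by move=> x _; exact: poweR_ge0.
- rewrite (_ : (fun x => _) = EFin \o (fun x => (normc \o f) x `^ r)); last first.
    by apply/funext => x /=; rewrite ger0_norm ?normc_ge0// poweR_EFin.
  apply/measurable_EFinP.
  exact: (measurableT_comp (measurable_powR r) mf).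
- by apply/measurable_EFinP; case/integrableP: (integrableZl measurableT (G `^ r) iI) => /measurable_EFinP.
move=> x _; rewrite /= ger0_norm ?normc_ge0// lee_fin.
apply: (@le_trans _ _ ((G / (1 + x ^+ 2)) `^ r)).
  by apply: ge0_ler_powR => //; rewrite ?nnegrE ?normc_ge0 ?divr_ge0// ltW.
rewrite powRM ?invr_ge0 ?(ltW (d0 x))// ler_wpM2l ?powR_ge0//.
apply: ge1r_powR; last exact: ltW.
by rewrite invr_gt0 d0 /= invf_le1.
Qed.

Lemma prod_ereal_le (I : finType) (a : I -> \bar R) (c : I -> R) :
  (forall i, (0 <= a i)%E) -> (forall i, (a i <= (c i)%:E)%E) ->
  (0 <= \prod_i a i)%E /\ (\prod_i a i <= (\prod_i c i)%:E)%E.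
Proof.
move=> a0 ac; apply: (big_ind2 (fun (y : \bar R) (z : R) => (0 <= y)%E /\ (y <= z%:E)%E)).
- by split.
- move=> y1 z1 y2 z2 [h1 h2] [h3 h4]; split; first exact: mule_ge0.
  by rewrite EFinM; exact: lee_pmul.
- by move=> i _; split.
Qed.

Lemma bump0E x : 0 < x -> x < 1 -> bump_derivn 0 x = expR (- (x * (1 - x))^-1).
Proof. by move=> x0 x1; rewrite /bump_derivn x0 x1 /bump_formula /= hornerC expr0 !mul1r. Qed.

Lemma Rintegral_bump_sqr_gt0 : 0 < \int[mu]_y (bump_derivn 0 y ^+ 2) :> R.
Proof.
pose c : R := expR (- 8) ^+ 2.
have c0 : 0 < c by rewrite exprn_gt0// expR_gt0.
have mD : measurable `[4^-1 : R, 2^-1] by [].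
apply: (@lt_le_trans _ _ (c * (2^-1 - 4^-1))); first by rewrite mulr_gt0//; lra.
have -> : c * (2^-1 - 4^-1) = \int[mu]_(y in `[4^-1, 2^-1]) c.
  rewrite Rintegral_cst//= lebesgue_measure_itv /= lte_fin.
  by rewrite ifT//; lra.
rewrite Rintegral_mkcond; apply: le_Rintegral => //.
- rewrite -restrict_EFin; apply/integrable_restrict => //; rewrite setTI.
  apply: continuous_compact_integrable; first exact: segment_compact.
  by apply: continuous_subspaceT; exact: cst_continuous.
- exact: integrable_csupp csupp_bump_sqr.
move=> y _; rewrite patchE; case: ifPn => [|_]; last exact: sqr_ge0.
rewrite inE /= in_itv /= => /andP[y1 y2].
have [p0 p1] : 0 < y /\ y < 1 by split; lra.
rewrite bump0E// /c lerXn2r ?nnegrE ?expR_ge0// ler_expR lerN2.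
have h : 8^-1 <= y * (1 - y) by nra.
by rewrite -[leRHS]invrK lef_pV2// posrE ?mulr_gt0 ?subr_gt0//; lra.
Qed.

(** At [x = 0] the transform is the integral of a nonnegative nonzero function; the bound
extends to a neighbourhood by continuity. *)
Lemma inv_fourier_bump_sqr_lower : exists h d : R, [/\ 0 < h, 0 < d &
  forall x, x \in `[0, d] -> h <= normc (inv_fourier (fun y => bump_derivn 0 y ^+ 2) x)].
Proof.
have I0 := Rintegral_bump_sqr_gt0; set I := (X in 0 < X) in I0.
have cI := is_derive_continuous (fun x => is_derive_Re_inv_fourier x csupp_bump_sqr) (x := 0).
have E0 : Re (inv_fourier (fun y => bump_derivn 0 y ^+ 2) 0) = I.
  by rewrite /= ; apply: eq_Rintegral => y _; rewrite mulr0 mul0r cos0 mulr1.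
exists (I / 2).
have : \forall x \near 0, I / 2 < Re (inv_fourier (fun y => bump_derivn 0 y ^+ 2) x).
  apply: (cvgr_gt _ cI); rewrite /= -[Rintegral _ _ _]/(Re (inv_fourier _ 0)) E0; lra.
move=> /nbhs_ballP [e e0 He]; rewrite /= in e0; exists (e / 2); split; [lra|lra|].
move=> x xd; apply: (le_trans _ (Re_le_normc _)); apply: (le_trans _ (ler_norm _)).
apply/ltW/He; move: xd; rewrite in_itv /ball /= => /andP[x0 x1].
by rewrite sub0r normrN ger0_norm//; lra.
Qed.

Lemma inv_fourier_bump_decay : exists C : R, 0 <= C /\
  forall x, normc (inv_fourier (bump_derivn 0) x) <= C / (1 + x ^+ 2).
Proof.
have [C HC] := quadratic_decay (fun j => inv_fourier_decay j ltr01 (@jet_bump R)).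
exists C; split => //.
have := le_trans (normc_ge0 _) (HC 0).
by rewrite expr0n addr0 divr1.
Qed.

End norms.

Section unboundedness.
Context {R : realType} (m : nat).
Local Notation n := m.+4.
Local Notation mu := (@lebesgue_measure R).
Local Notation normc := (@Normc.normc R).

Definition test_fun s (j : 'I_n) : R -> R[i] :=
  inv_fourier (packet_sum (2 ^ (s + extra_scale m)) (block_coef s j) 0).

Definition sign_symbol (b : bool) : 'rV[R]_n -> R[i] := clattice_symbol (sign_coef b) (fun=> 0%N).

Lemma normc_test_fun s j x : normc (test_fun s j x) <=
  Num.sqrt (2 * 2 ^+ (s + extra_scale m)) * normc (inv_fourier (bump_derivn 0) x).
Proof.
rewrite /test_fun inv_fourier_packet_sum Normc.normcM ler_wpM2r ?normc_ge0//.
rewrite -[leLHS]ger0_norm ?normc_ge0// -sqrtr_sqr ler_wsqrtr//.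
have := @normc_expsum_packet_coef R (2 ^ (s + extra_scale m)) (block_offset s j) (block_sign j) (block_size s j) x
  (fun q => @block_range_box m s j q).
move/le_trans; apply; rewrite ler_wpM2l// ler_eXn2l ?ltr1n//.
by rewrite /block_size; case: ifP => // _; rewrite leq_addr.
Qed.

Lemma multiplier_test_fun b s x :
  multiplier_op (sign_symbol b) (test_fun s) x =
  ((2 ^ s) ^ m.+2)%N%:R * rspoly b s (cexpi (2 * pi * x)) *
  inv_fourier (fun y => bump_derivn 0 y ^+ 2) x ^+ n.
Proof. by rewrite /sign_symbol /test_fun multiplier_op_clattice_symbol lattice_sum. Qed.

Lemma cmeasurable_multiplier_test_fun b s :
  cmeasurable (multiplier_op (sign_symbol b) (test_fun s)).
Proof.
rewrite (_ : multiplier_op _ _ = (fun x => \sum_(k < 2 ^ s)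
   (((2 ^ s) ^ m.+2)%N%:R * (rscoef b s k)%:C) * \prod_(i < k) cexpi (2 * pi * x)
   * \prod_(i < n) inv_fourier (fun y => bump_derivn 0 y ^+ 2) x)); last first.
  apply/funext => x; rewrite multiplier_test_fun /rspoly mulr_sumr mulr_suml.
  apply: eq_bigr => k _; rewrite !prodr_const !card_ord mulrA.
  by [].
have mc : cmeasurable (fun x : R => cexpi (2 * pi * x)).
  have [ccos csin] := continuous_cexpi (2 * pi : R).
  by apply: continuous_cmeasurable.
have mi : cmeasurable (inv_fourier (fun y : R => bump_derivn 0 y ^+ 2)).
  apply: continuous_cmeasurable.
    exact: is_derive_continuous (fun x => is_derive_Re_inv_fourier x csupp_bump_sqr).
  exact: is_derive_continuous (fun x => is_derive_Im_inv_fourier x csupp_bump_sqr).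
apply: cmeasurable_sum => k.
apply: cmeasurableM; last exact: cmeasurable_prod.
apply: cmeasurableM; last exact: cmeasurable_prod.
by split; exact: measurable_cst.
Qed.

End unboundedness.

(** * Unboundedness *)

Section contradiction.
Context {R : realType} (m : nat).
Local Notation n := m.+4.
Local Notation mu := (@lebesgue_measure R).
Local Notation normc := (@Normc.normc R).

Lemma cLnorm_powR (p : R) (f : R -> R[i]) : 0 < p ->
  (cLnorm mu p%:E f `^ p = \int[mu]_x (normc (f x) `^ p)%:E)%E.
Proof.
move=> p0; rewrite /cLnorm poweR_Lnorm ?gt_eqF//.
by apply: eq_integral => x _; rewrite /= ger0_norm ?normc_ge0.
Qed.

Lemma mhm_sign_symbol M b : mhm_symbol M (@weight_hyperplane R m.+3) (@sign_symbol R m b).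
Proof.
apply: mhm_clattice_symbol.
- exact: normr_sign_coef.
- move=> l e0; rewrite mem_weight_hyperplane; apply/eqP.
  have := congr1 (fun z : int => z%:~R : R) (sign_coef_neq0 e0).
  rewrite rmorph0 => {2}<-; rewrite rmorph_sum; apply: eq_bigr => j _.
  by rewrite mxE rmorphM.
- exact: dist_weight_hyperplane_gt0.
Qed.

Lemma test_fun_norms (p_ : 'I_n -> \bar R) : (forall j, (1 < p_ j)%E) ->
  exists D : R, 0 <= D /\ forall r,
    (\prod_j cLnorm mu (p_ j) (@test_fun R m (2 * r) j) <= (D * (2 ^+ r) ^+ n)%:E)%E.
Proof.
move=> p1; have [C [C0 HC]] := @inv_fourier_bump_decay R.
have /fin_all_exists [K HK] := fun j => cLnorm_decay (p1 j).
pose B : R := Num.sqrt (2 * 2 ^+ extra_scale m).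
have B0 : 0 <= B by exact: sqrtr_ge0.
exists (\prod_j (B * C * K j)); split.
  by apply: prodr_ge0 => j _; have [K0 _] := HK j; rewrite !mulr_ge0.
move=> r.
have P j : (cLnorm mu (p_ j) (@test_fun R m (2 * r) j) <=
    (2 ^+ r * (B * C * K j))%:E)%E.
  have [_ Kj] := HK j.
  rewrite mulrA [2 ^+ r * _]mulrA; apply: Kj.
  - by rewrite !mulr_ge0// exprn_ge0.
  - apply: measurable_normc; apply: continuous_cmeasurable.
      exact: (continuous_inv_fourier (jet_packet_sum _ _)).1.
    exact: (continuous_inv_fourier (jet_packet_sum _ _)).2.
  - move=> x; apply: (le_trans (normc_test_fun _ _ _)).
    have -> : Num.sqrt (2 * 2 ^+ (2 * r + extra_scale m)) = 2 ^+ r * B :> R.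
      rewrite exprD mulrCA sqrtrM ?exprn_ge0// mulnC exprM sqrtr_sqr.
      by rewrite ger0_norm// exprn_ge0.
    by rewrite -[leRHS]mulrA ler_wpM2l ?mulr_ge0 ?exprn_ge0.
have [_ ] := prod_ereal_le (fun j => Lnorm_ge0 _ _ _) P.
move/le_trans; apply; rewrite lee_fin big_split /= prodr_const card_ord.
by rewrite mulrC.
Qed.

(** With [N = 4^r], on an interval of fixed length one of the two outputs is at least a constant
times [(4^r)^(m+2) 2^r] at each point, while the product of the norms of the inputs is
[O((2^r)^(m+4))].  Adding the integrals of the [p]-th powers of both outputs
bounds [(2^r)^(m+1)] independently of [r]. *)
Lemma not_both_bounded (p_ : 'I_n -> \bar R) (p : R) : 0 < p ->
  (forall j, (1 < p_ j)%E) ->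
  (forall b, exists C : R, forall f : 'I_n -> R -> R[i],
      (forall j, schwartz (f j)) ->
      (cLnorm mu p%:E (multiplier_op (@sign_symbol R m b) f)
         <= C%:E * \prod_j cLnorm mu (p_ j) (f j))%E) -> False.
Proof.
move=> p0 p1 bd.
have [D [D0 HD]] := test_fun_norms p1.
have [Ct HCt] := bd true; have [Cf HCf] := bd false.
pose C := Num.max `|Ct| `|Cf|.
have C0 : 0 <= C by rewrite le_max normr_ge0.
pose T b r := multiplier_op (@sign_symbol R m b) (@test_fun R m (2 * r)).
have up b r : (cLnorm mu p%:E (T b r) <= (C * D * (2 ^+ r) ^+ n)%:E)%E.
  have Cb : exists2 c : R, c <= C & (cLnorm mu p%:E (T b r) <=
     c%:E * \prod_j cLnorm mu (p_ j) (@test_fun R m (2 * r) j))%E.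
    case: b.
      exists Ct; first by rewrite (le_trans (ler_norm _))// le_max lexx.
      by apply: HCt => j; exact: schwartz_inv_fourier_packet_sum.
    exists Cf; first by rewrite (le_trans (ler_norm _))// le_max lexx orbT.
    by apply: HCf => j; exact: schwartz_inv_fourier_packet_sum.
  have [c cC] := Cb; move/le_trans; apply.
  rewrite -mulrA EFinM; apply: (@le_trans _ _ (C%:E * \prod_j cLnorm mu (p_ j) (@test_fun R m (2 * r) j))%E).
    rewrite lee_wpmul2r ?lee_fin//.
    by apply: prode_ge0 => j _; exact: Lnorm_ge0.
  by rewrite lee_wpmul2l ?lee_fin.
have [h [d [h0 d0 Hh]]] := @inv_fourier_bump_sqr_lower R.
pose Lam r : R := (2 ^+ (2 * r)) ^+ m.+2 * 2 ^+ r * h ^+ n.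
have e2 k : 0 <= 2 ^+ k :> R by exact: exprn_ge0.
have CD0 r : 0 <= C * D * (2 ^+ r) ^+ n.
  by apply: mulr_ge0; [exact: mulr_ge0|exact: exprn_ge0 (e2 r)].
have hn : 0 <= h ^+ n by apply: exprn_ge0; exact: ltW.
have Lam0 r : 0 <= Lam r.
  by apply: mulr_ge0 => //; apply: mulr_ge0 => //; exact: exprn_ge0.

have pointwise r x : x \in `[0, d] -> Lam r `^ p <=
    normc (T true r x) `^ p + normc (T false r x) `^ p.
  move=> xd.
  have z1 : normc (cexpi (2 * pi * x)) = 1 by exact: normc_cexpi.
  have low b : 2 ^+ r <= normc (rspoly b (2 * r) (cexpi (2 * pi * x))) ->
      Lam r `^ p <= normc (T b r x) `^ p.
    move=> Pb; apply: ge0_ler_powR; rewrite ?nnegrE ?normc_ge0 ?(ltW p0)//.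
    have nX (z : R[i]) k : normc (z ^+ k) = normc z ^+ k.
      elim: k => [|k IH]; first by rewrite !expr0 Normc.normc1.
      by rewrite !exprS Normc.normcM IH.
    rewrite /T multiplier_test_fun Normc.normcM nX Normc.normcM.
    have -> : normc (((2 ^ (2 * r)) ^ m.+2)%N%:R) = (2 ^+ (2 * r)) ^+ m.+2 :> R.
      rewrite -(rmorph_nat (real_complex R)) normc_real ger0_norm//.
      by rewrite !natrX.
    rewrite /Lam ler_pM//.
    - by rewrite ler_wpM2l// exprn_ge0.
    - by rewrite lerXn2r ?nnegrE ?normc_ge0 ?(ltW h0)// Hh.
  have pair := @rspoly_pair R (2 * r) _ z1.
  have [Pt|Pt] := leP (2 ^+ r) (normc (rspoly true (2 * r) (cexpi (2 * pi * x)))).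
    by rewrite (le_trans (low _ Pt))// lerDl powR_ge0.
  have Pf : 2 ^+ r <= normc (rspoly false (2 * r) (cexpi (2 * pi * x))).
    rewrite leNgt; apply/negP => Pf.
    have sq (a : R) : 0 <= a -> a < 2 ^+ r -> a ^+ 2 < 2 ^+ (2 * r).
      by move=> a0 ar; rewrite mulnC exprM ltrXn2r ?nnegrE ?exprn_ge0.
    have := ltrD (sq _ (normc_ge0 _) Pt) (sq _ (normc_ge0 _) Pf).
    by rewrite pair; lra.
  by rewrite (le_trans (low _ Pf))// lerDr powR_ge0.
have mT b r : measurable_fun setT (fun x => (normc (T b r x) `^ p)%:E).
  apply/measurable_EFinP.
  have mN := measurable_normc (@cmeasurable_multiplier_test_fun R m b (2 * r)).
  exact: (measurableT_comp (measurable_powR p) mN).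
have int_up b r : (\int[mu]_x (normc (T b r x) `^ p)%:E <=
    ((C * D * (2 ^+ r) ^+ n) `^ p)%:E)%E.
  rewrite -cLnorm_powR// -poweR_EFin; apply: gt0_ler_poweR; first exact: ltW.
  - by rewrite in_itv /= leey andbT; exact: Lnorm_ge0.
  - by rewrite in_itv /= leey andbT lee_fin CD0.
  - exact: up.
have main r : Lam r `^ p * d <= 2 * (C * D * (2 ^+ r) ^+ n) `^ p.
  rewrite -lee_fin; apply: (@le_trans _ _ (\int[mu]_x
     ((normc (T true r x) `^ p)%:E + (normc (T false r x) `^ p)%:E))%E); last first.
    rewrite ge0_integralD//; [|by move=> x _; rewrite lee_fin powR_ge0|exact: mT
       |by move=> x _; rewrite lee_fin powR_ge0|exact: mT].
    by rewrite mulr_natl mulr2n EFinD; apply: leeD; exact: int_up.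
  apply: (@le_trans _ _ (\int[mu]_(x in `[0%R, d])
     ((normc (T true r x) `^ p)%:E + (normc (T false r x) `^ p)%:E))%E); last first.
    apply: ge0_subset_integral => //.
    - by apply: emeasurable_funD; exact: mT.
    - by move=> x _; rewrite -EFinD lee_fin addr_ge0 ?powR_ge0.
  have -> : (Lam r `^ p * d)%:E = (\int[mu]_(x in `[0%R, d]) (Lam r `^ p)%:E)%E.
    by rewrite integral_cst//= lebesgue_measure_itv /= lte_fin d0 oppr0 adde0 EFinM.
  apply: ge0_le_integral => //.
  - by move=> x _; rewrite lee_fin powR_ge0.
  - by apply: (measurable_funS measurableT) => //; apply: emeasurable_funD; exact: mT.
  - by move=> x xd; rewrite -EFinD lee_fin pointwise// inE.
pose E : R := (2 / d) `^ p^-1 * (C * D) / h ^+ n.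
have growth r : 2 ^+ r <= E.
  have t0 : 0 < 2 ^+ r :> R by rewrite exprn_gt0.
  have : (Lam r `^ p) `^ p^-1 <= (2 / d * (C * D * (2 ^+ r) ^+ n) `^ p) `^ p^-1.
    apply: ge0_ler_powR; rewrite ?nnegrE ?powR_ge0 ?mulr_ge0 ?invr_ge0 ?powR_ge0 ?(ltW d0) ?(ltW p0)//.
    by rewrite mulrAC ler_pdivlMr.
  rewrite [(2 / d * _) `^ _]powRM ?powR_ge0// ?divr_ge0 ?(ltW d0)// -!powRrM mulfV ?gt_eqF// !powRr1//.
  rewrite /Lam /E => H.
  rewrite ler_pdivlMr ?exprn_gt0//.
  have key : (2 ^+ (2 * r)) ^+ m.+2 * 2 ^+ r = (2 ^+ r) ^+ n * (2 ^+ r) ^+ m.+1 :> R.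
    rewrite mulnC exprM -exprM -exprSr -exprD; congr (_ ^+ _); lia.
  apply: (@le_trans _ _ ((2 ^+ r) ^+ m.+1 * h ^+ n)).
    rewrite ler_wpM2r ?exprn_ge0 ?(ltW h0)//.
    by rewrite exprS ler_peMr ?(ltW t0)// exprn_ege1// exprn_ege1// ler1n.
  have tn0 : 0 < (2 ^+ r) ^+ n :> R by rewrite exprn_gt0.
  rewrite -(ler_pM2l tn0) mulrA -key.
  by apply: (le_trans H); rewrite le_eqVlt; apply/orP; left; apply/eqP; ring.
have E0 : 0 <= E by apply: (le_trans _ (growth 0%N)); rewrite expr0.
have := archi_boundP E0; rewrite ltNge => /negP; apply.
apply: (le_trans _ (growth (Num.bound E))).
by rewrite -natrX ler_nat ltnW// ltn_expl.
Qed.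

End contradiction.

Unset Implicit Arguments.
Local Close Scope complex_scope.
Local Close Scope classical_set_scope.
Local Open Scope ring_scope.

Theorem theorem1p4 (R : realType) (M n : nat) (hn : (4 <= n)%N)
    (p_ : 'I_n -> \bar R) (p : R)
    (hp_ : forall j, (1 < p_ j)%E) (hp : 0 < p)
    (hsum : (\sum_j (p_ j)^-1 = (p%:E)^-1)%E) :
  exists (Gamma : {vspace 'rV[R]_n}) (m : 'rV[R]_n -> R[i]),
    [/\ nondegenerate_subspace Gamma, \dim Gamma = n.-1, mhm_symbol M Gamma m &
        ~ exists C : R, forall f : 'I_n -> R -> R[i],
            (forall j, schwartz (f j)) ->
            (cLnorm lebesgue_measure p%:E (multiplier_op m f)
             <= C%:E * \prod_j cLnorm lebesgue_measure (p_ j) (f j))%E].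
Proof.
case: n hn p_ hp_ hsum => [|[|[|[|m]]]] // _ p_ hp_ _.
pose bounded b := exists C : R, forall f : 'I_m.+4 -> R -> R[i]%C,
  (forall j, schwartz (f j)) ->
  (cLnorm lebesgue_measure p%:E (multiplier_op (@sign_symbol R m b) f)
   <= C%:E * \prod_j cLnorm lebesgue_measure (p_ j) (f j))%E.
have [b unb] : exists b, ~ bounded b.
  apply: contrapT => /forallNP H.
  by apply: (not_both_bounded hp hp_) => b; have /contrapT := H b.
exists (weight_hyperplane m.+3), (@sign_symbol R m b); split => //.
- exact: nondegenerate_weight_hyperplane.
- exact: dim_weight_hyperplane.
- exact: mhm_sign_symbol.
Qed.
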